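(* Let $\Omega\subset\mathbb{R}^3$ be a bounded domain with sufficiently smooth boundary, $\nu,\alpha,\mu>0$, $N\ge 1$ an integer, $h\in (L^2(\Omega))^3$ and $u_0,v_0\in V$. Let $v\in C([0,\infty);V)$ be the weak solution of the Navier-Stokes-Voigt system $$\partial_t v-\nu\Delta v-\alpha^2\Delta\partial_t v+(v\cdot\nabla)v+\nabla p=h,\quad \nabla\cdot v=0 \ \text{ in }\Omega\times(0,\infty),\qquad v|_{\partial\Omega}=0,\qquad v(x,0)=v_0(x),$$ and let $u\in C([0,\infty);V)$ be the solution of the feedback control system $$\partial_t u-\nu\Delta u-\alpha^2\Delta\partial_t u+(u\cdot\nabla)u+\nabla\tilde p=-\mu\sum_{k=1}^N(u-v,w_k)w_k+h,\quad \nabla\cdot u=0\ \text{ in }\Omega\times(0,\infty),\qquad u|_{\partial\Omega}=0,\qquad u(x,0)=u_0(x).$$ Suppose that $$\mu\ge C_1(\nu)\,r_0^2\,b_0^4,\qquad \nu-4\lambda_{N+1}^{-1}C_1(\nu)\,r_0^2\,b_0^4>0,$$ where $C_1(\nu)=\frac14\left(\frac{3}{2\nu}\right)^3$. Then there exists $t_0>0$ such that $$\|\nabla u(t)-\nabla v(t)\|\le k_0\,e^{-\kappa(t-t_0)}\,\|\nabla u(t_0)-\nabla v(t_0)\|\qquad\text{for all } t\ge t_0,$$ where $k_0=1+\frac{1}{\alpha^2\lambda_1}$ and $\kappa=\frac{\nu}{4}\min\{\lambda_1,\alpha^{-2}\}$.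
   Context: $(\cdot,\cdot)$ and $\|\cdot\|$ are the inner product and norm of $(L^2(\Omega))^3$ (and of $L^2(\Omega)$). Let $\mathcal V=\{u\in (C_0^\infty(\Omega))^3:\nabla\cdot u=0\}$; $V$ is the closure of $\mathcal V$ in $(H_0^1(\Omega))^3$. $w_1,w_2,\dots$ are the ($L^2$-orthonormal) eigenfunctions of the Stokes operator on $\Omega$ with homogeneous Dirichlet boundary condition, with corresponding eigenvalues $0<\lambda_1\le\lambda_2\le\cdots$. The constant $b_0>0$ is the constant in the 3D Ladyzhenskaya inequality $\|u\|_{L^4(\Omega)}^2\le b_0\|u\|^{1/2}\|\nabla u\|^{3/2}$ for all $u\in V$. The number $r_0$ (called the radius of the absorbing ball for the $v$-problem; it bounds $\|\nabla v(t)\|^2$ for large $t$) is $$r_0=\frac{2}{\nu\lambda_1 d_0\alpha^2}\|h\|^2,\qquad d_0=\frac{\nu}{2}\min\{\lambda_1,\alpha^{-2}\}.$$ Both problems have unique global solutions in $C([0,\infty);V)$ for initial data in $V$. *)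

(* Defs.v *)
From HB Require Import structures.
From mathcomp Require Import all_boot all_order all_algebra.
From mathcomp Require Import all_classical all_reals all_analysis.

Set Implicit Arguments.
Unset Strict Implicit.
Unset Printing Implicit Defensive.

Import Order.TTheory GRing.Theory Num.Theory.
Import numFieldNormedType.Exports.

Local Open Scope classical_set_scope.
Local Open Scope ring_scope.

Section NavierStokesVoigt.
Context {R : realType}.

(* R^3 is the iterated product R * R * R, which carries both the product
   topology and the product sigma-algebra; its max norm is only used
   topologically. *)
Definition scalar_field : Type := R * R * R -> R.
Definition vector_field : Type := 'I_3 -> R * R * R -> R.
Definition tensor_field : Type := 'I_3 -> 'I_3 -> R * R * R -> R.

(* R * R * R as a measurable space, with the Borel sigma-algebra on R *)
Definition R3 : Type :=
  (measurableTypeR R * measurableTypeR R * measurableTypeR R)%type.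

Definition leb3 :=
  ((@lebesgue_measure R \x @lebesgue_measure R) \x @lebesgue_measure R)%E.

Definition basis3 (i : 'I_3) : R * R * R :=
  (((i == 0%N :> nat)%:R, (i == 1%N :> nat)%:R), (i == 2%N :> nat)%:R).

Definition partial (i : 'I_3) (f : R * R * R -> R) : R * R * R -> R :=
  fun x => 'D_(basis3 i) f x.

Fixpoint Cfun (k : nat) (f : R * R * R -> R) : Prop :=
  continuous f /\
  if k is k'.+1
  then forall i, (forall x, derivable f x (basis3 i)) /\ Cfun k' (partial i f)
  else True.

(* C_0^oo(Omega), each function being extended by zero to R^3 *)
Definition test_function (Omega : set (R * R * R)) (f : R * R * R -> R) : Prop :=
  [/\ forall k, Cfun k f,
      compact (closure [set x | f x != 0]) &
      closure [set x | f x != 0] `<=` Omega].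

(* Near each boundary point, Omega is the set where a C^k function with nonzero
   gradient is negative. *)
Definition Ck_boundary (k : nat) (Omega : set (R * R * R)) : Prop :=
  forall x0, (closure Omega `\` interior Omega) x0 ->
    exists rho : R * R * R -> R,
      [/\ Cfun k rho,
          exists i, partial i rho x0 != 0 &
          \forall x \near x0, Omega x <-> rho x < 0].

Definition smooth_bounded_domain (Omega : set (R * R * R)) : Prop :=
  [/\ Omega !=set0, open Omega, connected Omega, bounded_set Omega &
      Ck_boundary 2 Omega].

Section Domain.
Variable Omega : set (R * R * R).

Definition L2 (f : scalar_field) : Prop :=
  measurable_fun (Omega : set R3) (f : R3 -> R) /\
  leb3.-integrable Omega (fun x => (f x ^+ 2)%:E).

Definition L2v (u : vector_field) : Prop := forall i, L2 (u i).
Definition L2t (G : tensor_field) : Prop := forall i j, L2 (G i j).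

Definition ip (f g : scalar_field) : R := \int[leb3]_(x in Omega) (f x * g x).
Definition ipv (u v : vector_field) : R := \sum_i ip (u i) (v i).
Definition ipt (G K : tensor_field) : R := \sum_i \sum_j ip (G i j) (K i j).

Definition normv (u : vector_field) : R := Num.sqrt (ipv u u).
Definition normt (G : tensor_field) : R := Num.sqrt (ipt G G).
Definition normH1 (u : vector_field) (G : tensor_field) : R :=
  Num.sqrt (ipv u u + ipt G G).

(* ||u||_{L^4(Omega)}, possibly +oo, for the Euclidean length of u(x) *)
Definition normL4 (u : vector_field) : \bar R :=
  'N[leb3]_(4%:E)[(fun x => (Num.sqrt (\sum_i u i x ^+ 2))%:E) \_ Omega].

Definition divergence_free_test (phi : vector_field) : Prop :=
  (forall i, test_function Omega (phi i)) /\
  (forall x, \sum_i partial i (phi i) x = 0).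

(* The entry (i, j) of a gradient is the j-th derivative of component i. *)
Definition classical_gradient (phi : vector_field) : tensor_field :=
  fun i j => partial j (phi i).

(* The fields below are functions and not classes modulo a.e. equality: the
   relations H1 u G, H10 u G and Vspace u G say that u belongs to the space and
   that G represents its weak gradient, which is unique only a.e. on Omega. *)
Definition H1 (u : vector_field) (G : tensor_field) : Prop :=
  [/\ L2v u, L2t G &
      forall i j phi, test_function Omega phi ->
        ip (u i) (partial j phi) = - ip (G i j) phi].

Definition H10 (u : vector_field) (G : tensor_field) : Prop :=
  H1 u G /\
  forall e : R, 0 < e -> exists phi : vector_field,
    (forall i, test_function Omega (phi i)) /\
    normH1 (u - phi) (G - classical_gradient phi) < e.

Definition Vspace (u : vector_field) (G : tensor_field) : Prop :=
  H10 u G /\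
  forall e : R, 0 < e -> exists phi : vector_field,
    divergence_free_test phi /\ normH1 (u - phi) (G - classical_gradient phi) < e.

Definition Hspace (u : vector_field) : Prop :=
  L2v u /\
  forall e : R, 0 < e -> exists phi : vector_field,
    divergence_free_test phi /\ normv (u - phi) < e.

(* u is in the domain of the Stokes operator A and A u = f: A is the operator
   in H associated with the Dirichlet form on V. *)
Definition stokes (u : vector_field) (Du : tensor_field) (f : vector_field) :
    Prop :=
  [/\ Vspace u Du, Hspace f &
      forall phi Dphi, Vspace phi Dphi -> ipt Du Dphi = ipv f phi].

Definition modes (w : nat -> vector_field) (n : nat) (f : vector_field) :
    vector_field :=
  fun i x => \sum_(k < n) ipv f (w k) * w k i x.

(* The eigenfunctions w_1, w_2, ... of the Stokes operator as an orthonormal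
   basis of H; completeness says that none is missing.  Indices start at 0: the
   usual lambda_k and w_k are lam k.-1 and w k.-1. *)
Record stokes_eigenbasis (lam : nat -> R) (w : nat -> vector_field)
    (Dw : nat -> tensor_field) : Prop := {
  eigen_gt0 : forall k, 0 < lam k ;
  eigen_nondecreasing : {homo lam : m n / (m <= n)%N >-> m <= n} ;
  eigen_stokes : forall k,
    stokes (w k) (Dw k) (fun i x => lam k * w k i x) ;
  eigen_orthonormal : forall k l, ipv (w k) (w l) = (k == l)%:R ;
  eigen_complete : forall f, Hspace f ->
    normv (f - modes w n f) @[n --> \oo] --> (0 : R) }.

Definition ladyzhenskaya_constant (b0 : R) : Prop :=
  0 < b0 /\
  forall u Du, Vspace u Du ->
    (normL4 u ^+ 2 <=
       (b0 * normv u `^ (1 / 2) * normt Du `^ (3 / 2))%:E)%E.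

(* (v . grad) v, with Dv the gradient of v *)
Definition advection (v : vector_field) (Dv : tensor_field) : vector_field :=
  fun i x => \sum_j v j x * Dv i j x.

(* Weak solutions in C([0, +oo); V) with forcing F; testing with the
   divergence-free fields of V eliminates the pressure. *)
Record nsv_weak_solution (nu alpha : R) (F : R -> vector_field)
    (v0 : vector_field) (v : R -> vector_field) (Dv : R -> tensor_field) :
    Prop := {
  nsv_in_V : forall t : R, 0 <= t -> Vspace (v t) (Dv t) ;
  nsv_continuous : forall t : R, 0 <= t ->
    normH1 (v s - v t) (Dv s - Dv t)
      @[s --> within [set s | 0 <= s] (nbhs t)] --> (0 : R) ;
  nsv_initial : forall i, ae_eq leb3 Omega (v 0 i) (v0 i) ;
  nsv_equation : forall phi Dphi, Vspace phi Dphi -> forall t : R, 0 < t ->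
    is_derive t 1
      (fun s : R => ipv (v s) phi + alpha ^+ 2 * ipt (Dv s) Dphi)
      (ipv (F t) phi - nu * ipt (Dv t) Dphi
         - ipv (advection (v t) (Dv t)) phi) }.

(* - mu sum_(k <= N) (d, w_k) w_k + h *)
Definition feedback_force (mu : R) (N : nat) (w : nat -> vector_field)
    (h d : vector_field) : vector_field :=
  fun i x => - mu * modes w N d i x + h i x.

End Domain.

Definition C1 (nu : R) : R := 1 / 4 * (3 / (2 * nu)) ^+ 3.

(* Below, lam1 is the first Stokes eigenvalue and hnorm the L^2 norm of h. *)
Definition d0 (nu alpha lam1 : R) : R := nu / 2 * Num.min lam1 (alpha ^- 2).

Definition r0 (nu alpha lam1 hnorm : R) : R :=
  2 / (nu * lam1 * d0 nu alpha lam1 * alpha ^+ 2) * hnorm ^+ 2.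

Definition k0 (alpha lam1 : R) : R := 1 + 1 / (alpha ^+ 2 * lam1).

Definition kappa (nu alpha lam1 : R) : R := nu / 4 * Num.min lam1 (alpha ^- 2).

End NavierStokesVoigt.

(* Main.v *)
Require Import Defs.
From HB Require Import structures.
From mathcomp Require Import all_boot all_order all_algebra.
From mathcomp Require Import all_classical all_reals all_analysis.
From mathcomp Require Import measurable_realfun ring lra.

(* Let z = u - v and E = |z|^2 + alpha^2 |grad z|^2.  Testing the difference of
   the two systems with z gives
     E' / 2 = - nu |grad z|^2 - mu sum_(k <= N) (z, w_k)^2 - ((z . grad) v, z),
   and the claimed rate for the norm, as opposed to its square, requires
   E' <= - nu |grad z|^2.  The textbook estimate of the last term by
   |grad v| |z|_4^2 with |grad v|^2 <= r0 loses a factor 2 in the rate.  It is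
   recovered from two sources of slack: the energy estimate for v gives
   limsup |grad v|^2 <= r0 / 2, and since grad v has trace zero only the
   trace-free part of z (x) z contributes, whence the bound
   sqrt (2/3) |grad v| |z|_4^2.  Ladyzhenskaya and Young then leave
   nu / 4 |grad z|^2 + A |z|^2 with A <= min (mu, nu lambda_(N+1) / 4), which
   the damping of the modes k <= N and the spectral gap on the other modes
   absorb. *)

Import Order.TTheory GRing.Theory Num.Theory.
Import numFieldNormedType.Exports.

Local Open Scope classical_set_scope.
Local Open Scope ring_scope.

Set Implicit Arguments.
Unset Strict Implicit.
Unset Printing Implicit Defensive.

(** * Measurability and integration by parts on R^3 *)

Section Space.
Context {R : realType}.
Local Notation X := (R * R * R)%type.

(** A weak solution is differentiable in time only after pairing with a fixed element of V, whereas
    the energy pairs it with itself. The Voigt term closes this gap: for [alpha > 0] the energy form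
    dominates the full H^1 norm, so the right-hand side is a bounded functional for that form, the
    solution is locally Lipschitz in it, and the error made by freezing one argument of the energy
    is quadratic in time. The numbers fit as follows. With |grad v|^2 <= rho the coefficient of
    |z|^2 is A = 3 b0^4 rho^2 / nu^3. At rho = r0 / 2 this is 8/9 of C1 r0^2 b0^4, the quantity that
    the two hypotheses compare with mu and with nu lambda_(N+1) / 4. The missing ninth leaves room
    for rho = r0 / 2 + e, since r0 / 2 only bounds the limsup and the estimate must hold from a
    finite time on. The rate kappa is d0 / 2: E' <= - nu |grad z|^2 <= - d0 E controls squared norms
    at rate d0. *)

Lemma open_measurable3 (U : set X) : open U -> measurable (U : set (@R3 R)).
Proof.
move=> oU.
(* The sigma-algebra is the product one, so openness is used through a countable cover by cubes with
   rational centres and radii 1/(n+1), each replaced by the empty set unless it lies in U. *)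
pose B (i : rat * rat * rat * nat) : set X :=
  ball (((ratr i.1.1.1 : R), (ratr i.1.1.2 : R)), (ratr i.1.2 : R)) i.2.+1%:R^-1.
pose F i := if `[< B i `<=` U >] then B i else set0.
have -> : U = \bigcup_i F i.
  apply/seteqP; split => [x Ux|x [i _]]; last first.
    by rewrite /F; case: asboolP => // BU; apply: BU.
  have /nbhs_ballP[e /= e0 eU] : nbhs x U by apply: open_nbhs_nbhs.
  have [n ne] : exists n : nat, 0 + n.+1%:R^-1 < e / 2.
    by apply: ltr_add_invr; rewrite divr_gt0.
  rewrite add0r in ne.
  pose r : R := n.+1%:R^-1.
  have r0 : 0 < r by rewrite invr_gt0 ltr0n.
  have H (y : R) : exists q : rat, ball (ratr q : R) r y.
    have [|q] := @rat_in_itvoo R (y - r) (y + r); first lra.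
    rewrite in_itv /= => /andP[q1 q2]; exists q.
    by rewrite /ball /= ltr_norml; apply/andP; split; lra.
  have [q1 h1] := H x.1.1; have [q2 h2] := H x.1.2; have [q3 h3] := H x.2.
  have Bx : B (q1, q2, q3, n) x by split; [split|].
  exists (q1, q2, q3, n) => //.
  rewrite /F; case: asboolP => // nB; exfalso; apply: nB => y By.
  (* Both points lie within r of the rational centre, and 2r < e. *)
  apply: eU; apply: (@le_ball _ _ _ (r + r)).
    by rewrite -/r in ne; clearbody r; lra.
  by apply: ball_triangle By; apply: ball_sym.
apply: countable_bigcupT_measurable; first exact: countableP.
move=> i; rewrite /F; case: ifP => // _.
rewrite (_ : B i = (ball (ratr i.1.1.1 : R) i.2.+1%:R^-1 `*`
   ball (ratr i.1.1.2 : R) i.2.+1%:R^-1) `*`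
   ball (ratr i.1.2 : R) i.2.+1%:R^-1) //.
by apply: measurableX; [apply: measurableX|]; apply: measurable_ball.
Qed.

Lemma continuous_measurable3 (f : X -> R) :
  continuous f -> measurable_fun [set: @R3 R] (f : @R3 R -> R).
Proof.
move=> cf; apply: (measurability _ (@RGenOpens.measurableE R)).
move=> _ [_ [a [b ->] <-]]; rewrite setTI.
by apply: open_measurable3; apply: open_comp.
Qed.

Lemma prod_ball0 (M : R) :
  (ball (0 : R) M `*` ball (0 : R) M) `*` ball (0 : R) M = [set x : X | `|x| < M].
Proof.
apply/seteqP; split => x /=; rewrite !prod_normE /= !gt_max -!ball_normE /ball_ /=.
  by rewrite !sub0r !normrN => -[[-> ->] ->].
by rewrite !sub0r !normrN => /andP[/andP[-> ->] ->].
Qed.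

Lemma measurable_normball (M : R) : measurable ([set x : X | `|x| < M] : set (@R3 R)).
Proof.
rewrite -prod_ball0.
by apply: measurableX; [apply: measurableX|]; apply: measurable_ball.
Qed.

Lemma leb_ball_fin (M : R) : (@lebesgue_measure R (ball (0 : R)%R M) < +oo)%E.
Proof.
have [M0|M0] := leP 0 M; first by rewrite lebesgue_measure_ball ?ltry.
rewrite (_ : ball _ _ = set0) ?measure0 ?ltry//.
apply/seteqP; split => // x; rewrite -ball_normE /ball_ /=.
by have := normr_ge0 (0 - x); lra.
Qed.

Lemma leb2_box_fin (M : R) :
  ((@lebesgue_measure R \x @lebesgue_measure R)%E
    (ball (0 : R)%R M `*` ball (0 : R)%R M) < +oo)%E.
Proof.
rewrite product_measure1E; try exact: measurable_ball.
by apply: lte_mul_pinfty => //; [rewrite ge0_fin_numE //|]; exact: leb_ball_fin.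
Qed.

Lemma leb2_sigma_finite : sigma_finite setT (@lebesgue_measure R \x @lebesgue_measure R)%E.
Proof.
exists (fun n => ball (0 : R) n%:R `*` ball (0 : R) n%:R).
  apply/seteqP; split => // -[a b] _.
  exists (Num.Def.trunc (`|a| + `|b|)).+1 => //.
  have := truncnS_gt (`|a| + `|b|); have := normr_ge0 a; have := normr_ge0 b.
  by move=> *; split; rewrite -ball_normE /ball_ /= sub0r normrN; lra.
move=> n; split; last exact: leb2_box_fin.
by apply: measurableX; apply: measurable_ball.
Qed.

(* The sigma-finite structure that the library infers on a product of measures
   is restricted to subprobabilities, so the one used by Fubini is packed here. *)
Definition leb2 :
    {sigma_finite_measure set (measurableTypeR R * measurableTypeR R)%type -> \bar R} :=
  HB.pack (@lebesgue_measure R \x @lebesgue_measure R)%E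
    (Measure_isSigmaFinite.Build _ _ _ _ leb2_sigma_finite).

Lemma leb3_ball_fin (M : R) : (leb3 [set x : X | (`|x| < M)%R] < +oo)%E.
Proof.
rewrite -prod_ball0 /leb3 product_measure1E; last 2 first.
- by apply: measurableX; apply: measurable_ball.
- exact: measurable_ball.
apply: lte_mul_pinfty => //; last exact: leb_ball_fin.
by rewrite ge0_fin_numE; first exact: leb2_box_fin.
Qed.

End Space.

Lemma integrable_bounded_support d (T : measurableType d) (R : realType)
    (mu : {measure set T -> \bar R}) (A : set T) (f : T -> R) (K : R) :
  measurable A -> (mu A < +oo)%E -> measurable_fun setT f ->
  (forall x, `|f x| <= K) -> (forall x, ~ A x -> f x = 0) ->
  mu.-integrable setT (EFin \o f).
Proof.
move=> mA muA mf fK f0.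
have -> : EFin \o f = (EFin \o f) \_ A.
  apply/funext => x; rewrite patchE; case: ifPn => // /negP; rewrite inE => /f0 /=.
  by move=> ->.
apply/(@integrable_mkcond _ _ _ _ _ (EFin \o f) mA).
apply: measurable_bounded_integrable => //; first exact: measurable_funS mf.
by exists K; split; [exact: num_real|move=> M KM x _ /=; apply: le_trans (fK x) (ltW KM)].
Qed.

Section ZeroIntegral.
Context {R : realType}.
Local Notation X := (R * R * R)%type.
Local Notation leb := (@lebesgue_measure R).

Lemma integral_derive0 (F g : R -> R) (M : R) :
  continuous g -> (forall t : R, is_derive t 1 F (g t)) ->
  (forall t, M <= `|t| -> F t = 0) -> (forall t, M <= `|t| -> g t = 0) ->
  (\int[leb]_t (g t)%:E = 0)%E.
Proof.
move=> cg dF F0 g0.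
(* Since [M] may be negative, it is enlarged to a positive [K], so that [-K, K] is a genuine
   interval. *)
pose K : R := `|M| + 1.
have K0 : 0 < K by rewrite /K; have := normr_ge0 M; lra.
have MK : M <= K by rewrite /K; have := ler_norm M; lra.
have F0' t : K <= `|t| -> F t = 0 by move=> h; apply: F0; apply: le_trans h.
have g0' t : K <= `|t| -> g t = 0 by move=> h; apply: g0; apply: le_trans h.
have cF : continuous F.
  by move=> t; apply: differentiable_continuous; apply/derivable1_diffP; case: (dF t).
have -> : (\int[leb]_t (g t)%:E = \int[leb]_(t in `[(- K)%R, K]) (g t)%:E)%E.
  rewrite [RHS]integral_mkcond; apply: eq_integral => t _.
  rewrite patchE; case: ifPn => // /negP; rewrite inE /= in_itv /= => h.
  rewrite g0' //; case: (lerP K `|t|) => //; rewrite ltr_norml => /andP[h1 h2].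
  by exfalso; apply: h; rewrite !ltW.
rewrite (@continuous_FTC2 _ _ F).
- by rewrite !F0' ?normrN ?gtr0_norm // subee.
- lra.
- exact: continuous_subspaceT.
- split; first by move=> x _; case: (dF x).
  + by apply: cvg_at_right_filter; apply: cF.
  + by apply: cvg_at_left_filter; apply: cF.
- by move=> x _; rewrite derive1E; case: (dF x).
Qed.

(** The curve [c] runs along a line in direction i, so the directional derivative becomes an
    ordinary one; |t| <= |c t| carries the bounded support over to the parameter. *)
Lemma slice_derive0 (i : 'I_3) (f : X -> R) (M : R) (c : R -> X) :
  (forall s t, c (s + t) = s *: basis3 i + c t) ->
  (forall t, `|t| <= `|c t|) ->
  (forall y, derivable f y (basis3 i)) -> continuous (partial i f) ->
  (forall y, M <= `|y| -> f y = 0) -> (forall y, M <= `|y| -> partial i f y = 0) ->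
  (\int[leb]_t (partial i f (c t))%:E = 0)%E.
Proof.
move=> cD cn df cdf f0 df0.
have cc : continuous c.
  move=> t; have -> : c = fun s => (s - t) *: basis3 i + c t.
    by apply/funext => s; rewrite -cD subrK.
  apply: cvgD; last exact: cvg_cst.
  apply: cvgZr_tmp; apply: cvgB; [exact: cvg_id|exact: cvg_cst].
apply: (@integral_derive0 (f \o c) _ M).
- by move=> t; apply: continuous_comp; [exact: cc|exact: cdf].
- move=> t.
  have E : (fun h : R => h^-1 *: (((f \o c) \o shift t) (h *: (1 : R)) - (f \o c) t)) =
      (fun h : R => h^-1 *: ((f \o shift (c t)) (h *: basis3 i) - f (c t))).
    by apply/funext => h /=; rewrite /shift /= cD scaler1.
  split; first by rewrite /derivable E; exact: df.
  by rewrite /derive E.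
- by move=> t h /=; apply: f0; apply: le_trans h (cn t).
- by move=> t h /=; apply: df0; apply: le_trans h (cn t).
Qed.

Lemma compact_support_bounds (f : X -> R) :
  continuous f -> compact (closure [set x | f x != 0]) ->
  exists M, [/\ 0 < M, forall x, `|f x| <= M & forall x, M <= `|x| -> f x = 0].
Proof.
move=> cf cs.
have [K1 [_ H1]] : bounded_set (f @` closure [set x | f x != 0]).
  by apply: compact_bounded; apply: continuous_compact => //; exact: continuous_subspaceT.
have [K2 [_ H2]] := compact_bounded cs.
pose M := `|K1| + `|K2| + 1.
have := ler_norm K1; have := ler_norm K2; have := normr_ge0 K1; have := normr_ge0 K2.
move=> k1 k2 k3 k4.
have out x : f x != 0 -> closure [set x | f x != 0] x by move=> h; apply: subset_closure.
exists M; split => [|x|x]; rewrite ?/M.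
- lra.
- have [->|/out h] := eqVneq (f x) 0; first by rewrite normr0; lra.
  by apply: (H1 M); [rewrite /M; lra|exists x].
- move=> h; apply/eqP; apply: contraT => /out.
  have k5 : K2 < `|K2| + 1 / 2 by lra.
  by move/(H2 _ k5) => /= h'; move: h; rewrite /M; lra.
Qed.

(** Fubini in the order that makes direction i innermost: each innermost integral is that of the
    derivative of a compactly supported function of one variable. *)
Lemma integral_partial0 (i : 'I_3) (f : X -> R) (M : R) :
  (forall y, derivable f y (basis3 i)) -> continuous (partial i f) ->
  (forall x, `|partial i f x| <= M) ->
  (forall y, M <= `|y| -> f y = 0) -> (forall y, M <= `|y| -> partial i f y = 0) ->
  (\int[leb3]_x (partial i f x)%:E = 0)%E.
Proof.
move=> df cdf dfM f0 df0.
set g := partial i f in cdf dfM df0 *.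
have mg : measurable_fun [set: @R3 R] (g : @R3 R -> R) by exact: continuous_measurable3.
have ig : (leb2 \x leb)%E.-integrable setT (EFin \o (g : @R3 R -> R)).
  apply: (@integrable_bounded_support _ (@R3 R) R leb3 [set x : X | `|x| < M] _ M) => //.
  - exact: measurable_normball.
  - exact: leb3_ball_fin.
  - by move=> x /negP; rewrite -leNgt => /df0.
have I12 := @integral12_prod_meas1 _ _ (measurableTypeR R * measurableTypeR R)%type
  (measurableTypeR R) R leb2 leb _ ig.
have I21 := @integral21_prod_meas1 _ _ (measurableTypeR R * measurableTypeR R)%type
  (measurableTypeR R) R leb2 leb _ ig.
(* The second use of Fubini, in the plane, needs every slice integrable; boundedness and bounded
   support are inherited. *)
have ig2 c : leb2.-integrable setT (EFin \o (fun p => g (p, c))).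
  apply: (@integrable_bounded_support _ (measurableTypeR R * measurableTypeR R)%type R
    leb2 (ball (0 : R) M `*` ball (0 : R) M) _ M).
  - by apply: measurableX; apply: measurable_ball.
  - exact: leb2_box_fin.
  - exact: measurable_fun_pair1.
  - by move=> x; exact: dfM.
  - move=> x h; apply: df0; rewrite leNgt; apply/negP => h'; apply: h.
    by have : [set x : X | `|x| < M] (x, c) by []; rewrite -prod_ball0 => -[].
have J12 c := @integral12_prod_meas1 _ _ _ _ R leb leb _ (ig2 c).
have J21 c := @integral21_prod_meas1 _ _ _ _ R leb leb _ (ig2 c).
have slice0 (c : R -> X) : (forall s t, c (s + t) = s *: basis3 i + c t) ->
    (forall t, `|t| <= `|c t|) -> (\int[leb]_t (g (c t))%:E = 0)%E.
  by move=> h1 h2; apply: (@slice_derive0 i f M c).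
have [i0|[i1|i2]] : i = 0%N :> nat \/ i = 1%N :> nat \/ i = 2%N :> nat.
  by case: (i : 'I_3) => -[|[|[|//]]] /= _; auto.
- apply: etrans; first by apply: esym; exact: I21.
  apply: integral0_eq => z _; apply: etrans; first by apply: esym; exact: J21.
  apply: integral0_eq => y _; apply: (slice0 (fun t => ((t, y), z))) => [s t|t].
  + by rewrite /basis3 i0; congr (_, _, _); rewrite /= ?scaler0 ?add0r// [_ *: _]mulr1.
  + by rewrite !prod_normE /= !le_max lexx.
- apply: etrans; first by apply: esym; exact: I21.
  apply: integral0_eq => z _; apply: etrans; first by apply: esym; exact: J12.
  apply: integral0_eq => y _; apply: (slice0 (fun t => ((y, t), z))) => [s t|t].
  + by rewrite /basis3 i1; congr (_, _, _); rewrite /= ?scaler0 ?add0r// [_ *: _]mulr1.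
  + by rewrite !prod_normE /= !le_max lexx orbT.
- apply: etrans; first by apply: esym; exact: I12.
  apply: integral0_eq => -[a b] _; apply: (slice0 (fun t => ((a, b), t))) => [s t|t].
  + by rewrite /basis3 i2; congr (_, _, _); rewrite /= ?scaler0 ?add0r// [_ *: _]mulr1.
  + by rewrite !prod_normE /= !le_max lexx orbT.
Qed.

End ZeroIntegral.

(** * Positive semidefinite forms *)

Section PsdForm.
Context {R : realType}.

(** Fields are functions and not classes, so the forms are only semidefinite; integrals are additive
    only where they converge, hence the domain [S]. The same interface serves the L^2, H^1 and Voigt
    products. *)
Record psd_form (V : lmodType R) (S : V -> Prop) (a : V -> V -> R) : Prop := {
  psd_S0 : S 0 ;
  psd_SD : forall x y, S x -> S y -> S (x + y) ;
  psd_SZ : forall k x, S x -> S (k *: x) ;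
  psd_sym : forall x y, a x y = a y x ;
  psd_Dl : forall x y z, S x -> S y -> S z -> a (x + y) z = a x z + a y z ;
  psd_Zl : forall k x y, S x -> S y -> a (k *: x) y = k * a x y ;
  psd_ge0 : forall x, S x -> 0 <= a x x }.

Section Theory.
Context (V : lmodType R) (S : V -> Prop) (a : V -> V -> R).
Hypothesis Pa : psd_form S a.
Implicit Types x y z : V.

Lemma psd_SN x : S x -> S (- x).
Proof. by move=> Sx; rewrite -scaleN1r; exact: (psd_SZ Pa _ Sx). Qed.

Lemma psd_SB x y : S x -> S y -> S (x - y).
Proof. by move=> Sx Sy; apply: (psd_SD Pa Sx); exact: psd_SN. Qed.

Lemma psd_Dr x y z : S x -> S y -> S z -> a z (x + y) = a z x + a z y.
Proof. by move=> *; rewrite !(psd_sym Pa z); exact: (psd_Dl Pa). Qed.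

Lemma psd_Zr k x y : S x -> S y -> a y (k *: x) = k * a y x.
Proof. by move=> *; rewrite !(psd_sym Pa y); exact: (psd_Zl Pa). Qed.

Lemma psd_Nl x y : S x -> S y -> a (- x) y = - a x y.
Proof. by move=> Sx Sy; rewrite -scaleN1r (psd_Zl Pa _ Sx Sy) mulN1r. Qed.

Lemma psd_Nr x y : S x -> S y -> a x (- y) = - a x y.
Proof. by move=> *; rewrite (psd_sym Pa) psd_Nl// (psd_sym Pa). Qed.

Lemma psd_Bl x y z : S x -> S y -> S z -> a (x - y) z = a x z - a y z.
Proof.
by move=> Sx Sy Sz; rewrite (psd_Dl Pa Sx (psd_SN Sy) Sz) psd_Nl.
Qed.

Lemma psd_Br x y z : S x -> S y -> S z -> a z (x - y) = a z x - a z y.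
Proof. by move=> *; rewrite !(psd_sym Pa z); exact: psd_Bl. Qed.

Lemma psd_0l x : S x -> a 0 x = 0.
Proof. by move=> Sx; rewrite -(scale0r x) (psd_Zl Pa _ Sx Sx) mul0r. Qed.

Lemma psd_S_sum (I : Type) (r : seq I) (F : I -> V) :
  (forall i, S (F i)) -> S (\sum_(i <- r) F i).
Proof. by move=> SF; apply: big_ind => // *; [exact: (psd_S0 Pa)|exact: (psd_SD Pa)]. Qed.

Lemma psd_suml (I : Type) (r : seq I) (F : I -> V) x :
  (forall i, S (F i)) -> S x -> a (\sum_(i <- r) F i) x = \sum_(i <- r) a (F i) x.
Proof.
move=> SF Sx; elim: r => [|i r IH]; first by rewrite !big_nil psd_0l.
by rewrite !big_cons -IH; apply: (psd_Dl Pa) => //; exact: psd_S_sum.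
Qed.

Lemma psd_sqrD x y : S x -> S y -> a (x + y) (x + y) = a x x + 2 * a x y + a y y.
Proof.
move=> Sx Sy; have Sxy := psd_SD Pa Sx Sy.
rewrite (psd_Dl Pa)// !psd_Dr// (psd_sym Pa y x); lra.
Qed.

Lemma psd_cauchy_schwarz x y : S x -> S y -> a x y ^+ 2 <= a x x * a y y.
Proof.
move=> Sx Sy.
have P t : 0 <= a x x + 2 * (t * a x y) + t ^+ 2 * a y y.
  have Sty := psd_SZ Pa t Sy.
  have := psd_ge0 Pa (psd_SD Pa Sx Sty).
  by rewrite psd_sqrD// !psd_Zr// (psd_Zl Pa)// expr2; lra.
have := psd_ge0 Pa Sx; have := psd_ge0 Pa Sy.
set X := a x x in P *; set Y := a y y in P *; set Z := a x y in P *.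
rewrite le_eqVlt => /orP[/eqP Y0|Y0] X0.
  have [->|Z0] := eqVneq Z 0; first by rewrite expr0n /= -Y0 mulr0.
  (* In the degenerate case a(y, y) = 0 the polynomial is affine in t, and this t would give it the
     value -1. *)
  have := P (- (X + 1) / (2 * Z)); rewrite -Y0 mulr0 addr0.
  have -> : - (X + 1) / (2 * Z) * Z = - (X + 1) / 2 by field.
  lra.
(* The minimiser in t. *)
have := P (- Z / Y).
have -> : X + 2 * (- Z / Y * Z) + (- Z / Y) ^+ 2 * Y = (X * Y - Z ^+ 2) / Y.
  by field; rewrite gt_eqF.
by rewrite pmulr_lge0 ?invr_gt0// subr_ge0.
Qed.

Lemma psd_cauchy_schwarz_sqrt x y : S x -> S y ->
  `|a x y| <= Num.sqrt (a x x) * Num.sqrt (a y y).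
Proof.
move=> Sx Sy; rewrite -sqrtrM ?(psd_ge0 Pa)// -sqrtr_sqr ler_wsqrtr//.
exact: psd_cauchy_schwarz.
Qed.

Lemma psd_triangle x y : S x -> S y ->
  Num.sqrt (a (x + y) (x + y)) <= Num.sqrt (a x x) + Num.sqrt (a y y).
Proof.
move=> Sx Sy.
have h : 0 <= Num.sqrt (a x x) + Num.sqrt (a y y) by rewrite addr_ge0 ?sqrtr_ge0.
rewrite -[leRHS]ger0_norm// -[leRHS]sqrtr_sqr ler_wsqrtr//.
rewrite psd_sqrD// sqrrD !sqr_sqrtr ?(psd_ge0 Pa)// -mulr_natr.
have := psd_cauchy_schwarz_sqrt Sx Sy.
by have := ler_norm (a x y); lra.
Qed.

End Theory.

(** Applied twice: from scalar to vector fields, then to tensor fields. *)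
Lemma psd_form_fun (V : lmodType R) S a (n : nat) : psd_form S a ->
  psd_form (fun u : 'I_n -> V => forall i, S (u i))
    (fun u v => \sum_i a (u i) (v i)).
Proof.
move=> Pa; split.
- by move=> i; exact: (psd_S0 Pa).
- by move=> x y Sx Sy i; exact: (psd_SD Pa).
- by move=> k x Sx i; exact: (psd_SZ Pa).
- by move=> x y; apply: eq_bigr => i _; exact: (psd_sym Pa).
- move=> x y z Sx Sy Sz; rewrite -big_split; apply: eq_bigr => i _.
  exact: (psd_Dl Pa).
- by move=> k x y Sx Sy; rewrite mulr_sumr; apply: eq_bigr => i _; exact: (psd_Zl Pa).
- by move=> x Sx; apply: sumr_ge0 => i _; exact: (psd_ge0 Pa).
Qed.

Lemma psd_comp_le (V : lmodType R) (S : V -> Prop) a (n : nat) (u : 'I_n -> V) i :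
  psd_form S a -> (forall j, S (u j)) -> a (u i) (u i) <= \sum_j a (u j) (u j).
Proof.
move=> Pa Su; rewrite (bigD1 i)//= lerDl; apply: sumr_ge0 => j _.
exact: (psd_ge0 Pa).
Qed.

(** The weight c = 1 gives the H^1 form, c = alpha^2 the Voigt energy. *)
Lemma psd_form_pair (V W : lmodType R) S a T b (c : R) : 0 <= c ->
  psd_form S a -> psd_form T b ->
  psd_form (fun p : V * W => S p.1 /\ T p.2)
    (fun p q => a p.1 q.1 + c * b p.2 q.2).
Proof.
move=> c0 Pa Pb; split.
- by split; [exact: (psd_S0 Pa)|exact: (psd_S0 Pb)].
- by move=> x y [? ?] [? ?]; split; [apply: (psd_SD Pa)|apply: (psd_SD Pb)].
- by move=> k x [? ?]; split; [apply: (psd_SZ Pa)|apply: (psd_SZ Pb)].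
- by move=> x y; rewrite (psd_sym Pa) (psd_sym Pb).
- by move=> x y z [? ?] [? ?] [? ?]; rewrite /= (psd_Dl Pa)// (psd_Dl Pb)//; ring.
- by move=> k x y [? ?] [? ?]; rewrite /= (psd_Zl Pa)// (psd_Zl Pb)//; ring.
- by move=> x [? ?]; rewrite addr_ge0 ?mulr_ge0 ?(psd_ge0 Pa)// ?(psd_ge0 Pb).
Qed.

End PsdForm.

(** * Square-integrable fields *)

Section L2Forms.
Context {R : realType} (Omega : set (R * R * R)).
Hypothesis mO : measurable (Omega : set (@R3 R)).

Lemma L2_mul_integrable f g : L2 Omega f -> L2 Omega g ->
  leb3.-integrable (Omega : set (@R3 R)) (fun x => (f x * g x)%:E).
Proof.
move=> [mf intf] [mg intg].
apply: (@le_integrable _ (@R3 R) R leb3 Omega mO _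
  (fun x => (f x ^+ 2)%:E + (g x ^+ 2)%:E)%E).
- by apply/measurable_EFinP; exact: measurable_funM.
- move=> x _; rewrite -EFinD !abse_EFin lee_fin [leRHS]ger0_norm ?addr_ge0 ?sqr_ge0//.
  rewrite ler_norml; apply/andP; split; rewrite -subr_ge0.
    by have := sqr_ge0 (f x + g x); have := sqr_ge0 (f x); have := sqr_ge0 (g x); lra.
  by have := sqr_ge0 (f x - g x); have := sqr_ge0 (f x); have := sqr_ge0 (g x); lra.
- exact: integrableD.
Qed.

Lemma L2_intro (f : @scalar_field R) :
  measurable_fun (Omega : set (@R3 R)) (f : @R3 R -> R) ->
  (\int[leb3]_(x in Omega) (f x ^+ 2)%:E < +oo)%E -> L2 Omega f.
Proof.
move=> mf fi; split=> //; apply/integrableP; split.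
  by apply/measurable_EFinP; exact: measurable_funX.
by under eq_integral do rewrite abse_EFin ger0_norm ?sqr_ge0//.
Qed.

Lemma L2_psd : psd_form (V := @scalar_field R) (L2 Omega) (ip Omega).
Proof.
have S0 : L2 Omega (0 : @scalar_field R).
  apply: L2_intro; first exact: measurable_cst.
  by under eq_integral do rewrite expr0n /=; rewrite integral0.
have SD f g : L2 Omega f -> L2 Omega g -> L2 Omega ((f : @scalar_field R) + g).
  move=> Lf Lg; split; first by apply: measurable_funD; [case: Lf|case: Lg].
  have -> : (fun x => (((f : @scalar_field R) + g) x ^+ 2)%:E) =
      (fun x => (f x * f x)%:E + ((f x * g x)%:E + (f x * g x)%:E) + (g x * g x)%:E)%E.
    by apply/funext => x; rewrite -!EFinD; congr EFin; rewrite fctE; ring.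
  by do 3?[apply: (@integrableD _ (@R3 R) R leb3 Omega mO)]; exact: L2_mul_integrable.
have SZ k f : L2 Omega f -> L2 Omega (k *: (f : @scalar_field R)).
  move=> Lf; split; first by apply: measurable_funM; [exact: measurable_cst|case: Lf].
  have -> : (fun x => ((k *: (f : @scalar_field R)) x ^+ 2)%:E) =
      (fun x => (k ^+ 2)%:E * (f x * f x)%:E)%E.
    by apply/funext => x; rewrite -EFinM; congr EFin; rewrite fctE /GRing.scale /=; ring.
  by apply: (@integrableZl _ (@R3 R) R leb3 Omega mO); exact: L2_mul_integrable.
split => //.
- by move=> f g; rewrite /ip; under eq_Rintegral do rewrite mulrC.
- move=> f g h Lf Lg Lh; rewrite /ip.
  rewrite -(@RintegralD _ (@R3 R) R leb3 Omega (fun x => f x * h x) (fun x => g x * h x) mO).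
  + by apply: eq_Rintegral => x _; rewrite fctE mulrDl.
  + exact: L2_mul_integrable.
  + exact: L2_mul_integrable.
- move=> k f g Lf Lg; rewrite /ip.
  rewrite -(@RintegralZl _ (@R3 R) R leb3 Omega (fun x => f x * g x) k mO).
  + by apply: eq_Rintegral => x _; rewrite fctE /GRing.scale /= mulrA.
  + exact: L2_mul_integrable.
- by move=> f Lf; apply: Rintegral_ge0 => x _; rewrite -expr2 sqr_ge0.
Qed.

Lemma L2v_psd : psd_form (V := @vector_field R) (L2v Omega) (ipv Omega).
Proof. exact: psd_form_fun L2_psd. Qed.

Lemma L2t_psd : psd_form (V := @tensor_field R) (L2t Omega) (ipt Omega).
Proof. exact: psd_form_fun L2v_psd. Qed.

Lemma H1_psd (c : R) : 0 <= c ->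
  psd_form (V := (@vector_field R * @tensor_field R)%type)
    (fun p => L2v Omega p.1 /\ L2t Omega p.2)
    (fun p q => ipv Omega p.1 q.1 + c * ipt Omega p.2 q.2).
Proof. by move=> c0; apply: psd_form_pair => //; [exact: L2v_psd|exact: L2t_psd]. Qed.

Lemma L2_mul f g : L2 Omega f -> L2 Omega g ->
  L2 Omega (fun x => f x ^+ 2) -> L2 Omega (fun x => g x ^+ 2) ->
  L2 Omega (fun x => f x * g x).
Proof.
move=> [mf _] [mg _] L1 L2; split; first exact: measurable_funM.
have := L2_mul_integrable L1 L2; congr integrable.
by apply/funext => x; rewrite exprMn.
Qed.

End L2Forms.

Section L4.
Context {R : realType} (Omega : set (R * R * R)).
Hypothesis mO : measurable (Omega : set (@R3 R)).

Definition sqlen (u : @vector_field R) : @scalar_field R := fun x => \sum_i u i x ^+ 2.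

Lemma sqlen_ge0 u x : 0 <= sqlen u x.
Proof. by apply: sumr_ge0 => i _; exact: sqr_ge0. Qed.

Lemma measurable_sqlen u : L2v Omega u ->
  measurable_fun (Omega : set (@R3 R)) (sqlen u : @R3 R -> R).
Proof. by move=> Lu; apply: measurable_sum => i; apply: measurable_funX; case: (Lu i). Qed.

(** A finite bound excludes the value +oo of the extended norm; the L^4 bound then becomes an L^2
    bound on the squared length. *)
Lemma normL4_bound u (c : R) : L2v Omega u -> 0 <= c ->
  (normL4 Omega u ^+ 2 <= c%:E)%E ->
  L2 Omega (sqlen u) /\ ip Omega (sqlen u) (sqlen u) <= c ^+ 2.
Proof.
move=> Lu c0.
have E : (\int[leb3]_(x in Omega) (sqlen u x ^+ 2)%:E = normL4 Omega u `^ 4)%E.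
  rewrite /normL4 poweR_Lnorm// [LHS]integral_mkcond; apply: eq_integral => x _.
  rewrite !patchE; case: ifPn => _; last by rewrite /= normr0 powR0.
  rewrite /= ger0_norm ?sqrtr_ge0// (@powR_mulrn _ _ 4) ?sqrtr_ge0//.
  by rewrite (exprM _ 2 2) sqr_sqrtr// sqlen_ge0.
have N0 : (0 <= normL4 Omega u)%E by exact: Lnorm_ge0.
case: (normL4 Omega u) E N0 => [l| |] E N0 //.
rewrite -EFin_expe lee_fin => lc.
rewrite poweR_EFin (@powR_mulrn _ _ 4) // in E.
split.
  apply: L2_intro => //; first exact: measurable_sqlen.
  by rewrite E ltry.
rewrite /ip /Rintegral; under eq_integral do rewrite -expr2.
rewrite E /= (exprM _ 2 2); apply: lerXn2r => //; rewrite nnegrE//.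
exact: sqr_ge0.
Qed.

(** Squaring the inequality replaces the fractional powers by integer ones, so that later estimates
    are polynomial. *)
Lemma ladyzhenskaya_L4 (b0 : R) u Du : ladyzhenskaya_constant Omega b0 ->
  Vspace Omega u Du ->
  L2 Omega (sqlen u) /\
  ip Omega (sqlen u) (sqlen u) <= b0 ^+ 2 * normv Omega u * normt Omega Du ^+ 3.
Proof.
move=> [b00 Hb] Vu.
have Lu : L2v Omega u by case: Vu => -[[]].
set c := b0 * normv Omega u `^ (1 / 2) * normt Omega Du `^ (3 / 2).
have c0 : 0 <= c by rewrite !mulr_ge0 ?powR_ge0// ltW.
have [? le2] := normL4_bound Lu c0 (Hb u Du Vu); split => //.
apply: le_trans le2 _; rewrite /c !exprMn.
have P (x : R) (k : nat) : 0 <= x -> (x `^ (k%:R / 2)) ^+ 2 = x ^+ k.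
  by move=> x0; rewrite -powR_mulrn ?powR_ge0// -powRrM divfK ?pnatr_eq0// powR_mulrn.
by rewrite (P _ 1) ?sqrtr_ge0// (P _ 3) ?sqrtr_ge0// expr1.
Qed.

End L4.

(** * Test functions *)

Section TestFunctions.
Context {R : realType}.
Local Notation X := (R * R * R)%type.
Implicit Types (f g : X -> R) (i j : 'I_3).

Lemma continuous_add f g : continuous f -> continuous g -> continuous (f + g).
Proof. by move=> cf cg x; exact: (continuousD (cf x) (cg x)). Qed.

Lemma continuous_mul f g : continuous f -> continuous g -> continuous (f * g).
Proof. by move=> cf cg x; exact: (continuousM (cf x) (cg x)). Qed.

Lemma partialD i f g x : derivable f x (basis3 i) -> derivable g x (basis3 i) ->
  partial i (f + g) x = partial i f x + partial i g x.
Proof. exact: deriveD. Qed.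

Lemma partialM i f g x : derivable f x (basis3 i) -> derivable g x (basis3 i) ->
  partial i (f * g) x = f x * partial i g x + g x * partial i f x.
Proof. exact: deriveM. Qed.

Lemma Cfun_continuous k f : Cfun k f -> continuous f.
Proof. by case: k => [|k] []. Qed.

Lemma Cfun_derivable k f i x : Cfun k.+1 f -> derivable f x (basis3 i).
Proof. by move=> [_ /(_ i) []]. Qed.

Lemma Cfun_partial k f i : Cfun k.+1 f -> Cfun k (partial i f).
Proof. by move=> [_ /(_ i) []]. Qed.

Lemma CfunW k f : Cfun k.+1 f -> Cfun k f.
Proof.
elim: k f => [|k IH] f; first by case.
move=> Cf; split; first exact: Cfun_continuous Cf.
move=> i; split; first by move=> x; exact: Cfun_derivable Cf.
by apply: IH; exact: Cfun_partial.
Qed.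

Lemma Cfun_cst k (c : R) : Cfun k (cst c : X -> R).
Proof.
elim: k c => [|k IH] c; split=> //; try exact: cst_continuous.
move=> i; split; first by move=> x; exact: derivable_cst.
rewrite (_ : partial i _ = cst 0); first exact: IH.
by apply/funext => x; exact: derive_cst.
Qed.

Lemma Cfun_D k f g : Cfun k f -> Cfun k g -> Cfun k (f + g).
Proof.
elim: k f g => [|k IH] f g Cf Cg.
  by split=> //; exact: (continuous_add (Cfun_continuous Cf) (Cfun_continuous Cg)).
split.
  by exact: (continuous_add (Cfun_continuous Cf) (Cfun_continuous Cg)).
move=> i; split.
  by move=> x; apply: derivableD; [exact: Cfun_derivable Cf|exact: Cfun_derivable Cg].
rewrite (_ : partial i _ = partial i f + partial i g).
  by apply: IH; exact: Cfun_partial.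
by apply/funext => x; apply: partialD; [exact: Cfun_derivable Cf|exact: Cfun_derivable Cg].
Qed.

Lemma Cfun_M k f g : Cfun k f -> Cfun k g -> Cfun k (f * g).
Proof.
elim: k f g => [|k IH] f g Cf Cg.
  by split=> //; exact: (continuous_mul (Cfun_continuous Cf) (Cfun_continuous Cg)).
split.
  by exact: (continuous_mul (Cfun_continuous Cf) (Cfun_continuous Cg)).
move=> i; split.
  by move=> x; apply: derivableM; [exact: Cfun_derivable Cf|exact: Cfun_derivable Cg].
rewrite (_ : partial i _ = f * partial i g + g * partial i f).
  by apply: Cfun_D; apply: IH; (try exact: CfunW); exact: Cfun_partial.
by apply/funext => x; apply: partialM; [exact: Cfun_derivable Cf|exact: Cfun_derivable Cg].
Qed.

(** Outside the closed support, f agrees with 0 on a neighbourhood. *)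
Lemma partial_support i f x :
  partial i f x != 0 -> closure [set y | f y != 0] x.
Proof.
apply: contraPP => nx; apply/negP; rewrite negbK; apply/eqP.
have oC : open (~` closure [set y | f y != 0]) by apply: closed_openC; exact: closed_closure.
have f0 y : (~` closure [set y | f y != 0]) y -> f y = 0.
  by move=> ny; apply/eqP; apply: contra_notT ny => fy; apply: subset_closure.
have nC : nbhs x (~` closure [set y | f y != 0]) by exact: open_nbhs_nbhs.
rewrite /partial (@near_eq_derive _ _ _ f (cst 0)) ?derive_cst//.
exact: filterS nC.
Qed.

Section Omega.
Variable Omega : set X.
Local Notation test := (test_function Omega).

Lemma test_continuous f : test f -> continuous f.
Proof. by move=> [/(_ 0%N) []]. Qed.

Lemma test_compact f : test f -> compact (closure [set x | f x != 0]).
Proof. by case. Qed.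

Lemma test_derivable i x f : test f -> derivable f x (basis3 i).
Proof. by move=> [/(_ 1%N) /Cfun_derivable]. Qed.

(** Covers sums, products, multiples and derivatives at once: a closed subset of the union of two
    compact supports is compact. *)
Lemma test_of_support f g h : test f -> test g -> (forall k, Cfun k h) ->
  (forall x, h x != 0 ->
     (closure [set y | f y != 0] `|` closure [set y | g y != 0]) x) ->
  test h.
Proof.
move=> [_ kf sf] [_ kg sg] Ch hs.
have sub : closure [set x | h x != 0] `<=`
    closure [set y | f y != 0] `|` closure [set y | g y != 0].
  have cU : closed (closure [set y | f y != 0] `|` closure [set y | g y != 0]).
    by apply: closedU; exact: closed_closure.
  by rewrite [X in _ `<=` X](iffLR (closure_id _) cU); apply: closureS.
split => //.
  apply: subclosed_compact sub; first exact: closed_closure.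
  exact: compactU.
by apply: subset_trans sub _; rewrite subUset.
Qed.

Lemma test_D f g : test f -> test g -> test (f + g).
Proof.
move=> tf tg; apply: (test_of_support tf tg).
  by move=> k; apply: Cfun_D; [case: tf|case: tg].
move=> x; have [f0|f0 _] := eqVneq (f x) 0; last by left; apply: subset_closure.
by rewrite fctE f0 add0r => h; right; apply: subset_closure.
Qed.

Lemma test_M f g : test f -> test g -> test (f * g).
Proof.
move=> tf tg; apply: (test_of_support tf tg).
  by move=> k; apply: Cfun_M; [case: tf|case: tg].
move=> x; have [f0|f0 _] := eqVneq (f x) 0; last by left; apply: subset_closure.
by rewrite fctE f0 mul0r eqxx.
Qed.

Lemma test_Z (c : R) f : test f -> test (c *: f).
Proof.
move=> tf; have -> : c *: f = cst c * f by apply/funext.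
apply: (test_of_support tf tf).
  by move=> k; apply: Cfun_M; [exact: Cfun_cst|case: tf].
move=> x; have [f0|f0 _] := eqVneq (f x) 0; last by left; apply: subset_closure.
by rewrite fctE f0 mulr0 eqxx.
Qed.

Lemma test_partial f i : test f -> test (partial i f).
Proof.
move=> tf; apply: (test_of_support tf tf).
  by move=> k; apply: Cfun_partial; case: tf.
by move=> x /partial_support; left.
Qed.

Lemma partialZ (c : R) f i : test f -> partial i (c *: f) = c *: partial i f.
Proof.
move=> tf; apply/funext => x; rewrite /partial.
by apply: deriveZ; exact: test_derivable tf.
Qed.

Hypothesis mO : measurable (Omega : set (@R3 R)).
Hypothesis fO : (leb3 (Omega : set (@R3 R)) < +oo)%E.

Lemma test_L2 f : test f -> L2 Omega f.
Proof.
move=> tf; have [M [M0 fM _]] := compact_support_bounds (test_continuous tf) (test_compact tf).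
have mf : measurable_fun (Omega : set (@R3 R)) (f : @R3 R -> R).
  by apply: measurable_funS (continuous_measurable3 (test_continuous tf)).
split => //.
apply: (@measurable_bounded_integrable _ (@R3 R) R leb3 (fun x => f x ^+ 2) Omega mO fO).
  exact: measurable_funX.
exists (M ^+ 2); split; first exact: num_real.
move=> K KM x _ /=; apply: le_trans (ltW KM).
by rewrite normrX lerXn2r// nnegrE// ltW.
Qed.

(** No boundary term arises: the product has its support in Omega, so its derivative may be
    integrated over the whole space, where the integral vanishes. *)
Lemma test_ibp i f g : test f -> test g ->
  ip Omega f (partial i g) = - ip Omega (partial i f) g.
Proof.
move=> tf tg; have tfg := test_M tf tg; have tdfg := test_partial i tfg.
have PL2 := L2_psd mO.
have [M1 [M10 fM1 f01]] := compact_support_bounds (test_continuous tfg) (test_compact tfg).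
have [M2 [M20 fM2 f02]] := compact_support_bounds (test_continuous tdfg) (test_compact tdfg).
have E : (\int[leb3]_(x in Omega) (partial i (f * g) x)%:E = 0)%E.
  rewrite -[RHS](@integral_partial0 R i (f * g) (M1 + M2)).
  - rewrite [LHS]integral_mkcond; apply: eq_integral => x _; rewrite patchE; case: ifPn => //.
    rewrite notin_setE => nx; congr EFin; apply/esym/eqP.
    apply: contra_notT nx => h; case: tdfg => _ _; apply; exact: subset_closure.
  - by move=> y; exact: test_derivable tfg.
  - exact: test_continuous tdfg.
  - by move=> x; apply: le_trans (fM2 x) _; rewrite lerDr ltW.
  - by move=> y h; apply: f01; apply: le_trans h; rewrite lerDl ltW.
  - by move=> y h; apply: f02; apply: le_trans h; rewrite lerDr ltW.
apply/eqP; rewrite -addr_eq0; apply/eqP.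
have := congr1 fine E; rewrite /= => <-.
rewrite (psd_sym PL2 (partial i f)).
have I1 := L2_mul_integrable mO (test_L2 tf) (test_L2 (test_partial i tg)).
have I2 := L2_mul_integrable mO (test_L2 tg) (test_L2 (test_partial i tf)).
rewrite /ip -(@RintegralD _ (@R3 R) R leb3 Omega _ _ mO I1 I2).
rewrite /Rintegral; congr fine; apply: eq_integral => x _; congr EFin.
by rewrite partialM; [|exact: test_derivable tf|exact: test_derivable tg].
Qed.

End Omega.
End TestFunctions.

(** * The space V *)

Section VSpace.
Context {R : realType} (Omega : set (R * R * R)).
Hypothesis mO : measurable (Omega : set (@R3 R)).
Hypothesis fO : (leb3 (Omega : set (@R3 R)) < +oo)%E.
Implicit Types (u v w z phi psi : @vector_field R) (Du Dv Dw Dz G : @tensor_field R).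

Let P2 := L2_psd mO.
Let Pv := L2v_psd mO.
Let Pt := L2t_psd mO.
Let P1 := H1_psd mO (ler01 : (0 : R) <= 1).
Local Notation testv phi := (forall i, test_function Omega (phi i)).

Lemma normH1E u G : normH1 Omega u G =
  Num.sqrt (ipv Omega u u + 1 * ipt Omega G G).
Proof. by rewrite mul1r. Qed.

Lemma testv_L2v phi : testv phi -> L2v Omega phi.
Proof. by move=> tp i; exact: test_L2. Qed.

Lemma testv_L2t phi : testv phi -> L2t Omega (classical_gradient phi).
Proof. by move=> tp i j; apply: test_L2 => //; exact: test_partial. Qed.

Lemma classical_gradientD phi psi : testv phi -> testv psi ->
  classical_gradient (phi + psi) = classical_gradient phi + classical_gradient psi.
Proof.
move=> tp tq; apply/funext => i; apply/funext => j; apply/funext => x.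
by apply: partialD; [exact: test_derivable (tp i)|exact: test_derivable (tq i)].
Qed.

Lemma classical_gradientZ (c : R) phi : testv phi ->
  classical_gradient (c *: phi) = c *: classical_gradient phi.
Proof.
move=> tp; apply/funext => i; apply/funext => j.
exact: partialZ (tp i).
Qed.

Lemma H1_D u Du v Dv : H1 Omega u Du -> H1 Omega v Dv -> H1 Omega (u + v) (Du + Dv).
Proof.
move=> [Lu Lt wu] [Lv Ltv wv]; split.
- exact: (psd_SD Pv).
- exact: (psd_SD Pt).
- move=> i j phi tp.
  have Lp := test_L2 mO fO tp; have Ldp := test_L2 mO fO (test_partial j tp).
  by rewrite (psd_Dl P2)// (psd_Dl P2)// wu// wv// opprD.
Qed.

Lemma H1_Z (c : R) u Du : H1 Omega u Du -> H1 Omega (c *: u) (c *: Du).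
Proof.
move=> [Lu Lt wu]; split.
- exact: (psd_SZ Pv).
- exact: (psd_SZ Pt).
- move=> i j phi tp.
  have Lp := test_L2 mO fO tp; have Ldp := test_L2 mO fO (test_partial j tp).
  by rewrite (psd_Zl P2)// (psd_Zl P2)// wu// mulrN.
Qed.

Lemma H1_test phi : testv phi -> H1 Omega phi (classical_gradient phi).
Proof.
move=> tp; split; [exact: testv_L2v|exact: testv_L2t|].
by move=> i j psi tq; apply: test_ibp.
Qed.

(** The density clauses of [H10] and [Vspace] are the instances where [C] is all test fields or the
    divergence-free ones. *)
Definition test_approximable (C : @vector_field R -> Prop) u G :=
  forall e : R, 0 < e -> exists phi,
    C phi /\ normH1 Omega (u - phi) (G - classical_gradient phi) < e.

Section Approximable.
Variable C : @vector_field R -> Prop.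
Hypothesis Ctest : forall phi, C phi -> testv phi.
Hypothesis CD : forall phi psi, C phi -> C psi -> C (phi + psi).
Hypothesis CZ : forall (c : R) phi, C phi -> C (c *: phi).

Lemma approximable_D u Du v Dv :
  L2v Omega u -> L2t Omega Du -> L2v Omega v -> L2t Omega Dv ->
  test_approximable C u Du -> test_approximable C v Dv ->
  test_approximable C (u + v) (Du + Dv).
Proof.
move=> Lu LDu Lv LDv au av e e0.
have e20 : 0 < e / 2 by rewrite divr_gt0.
have [p [Cp hp]] := au _ e20; have [q [Cq hq]] := av _ e20.
exists (p + q); split; first exact: CD.
rewrite classical_gradientD; [|exact: Ctest|exact: Ctest].
have -> : u + v - (p + q) = (u - p) + (v - q) by rewrite opprD addrACA.
have -> : Du + Dv - (classical_gradient p + classical_gradient q) =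
  (Du - classical_gradient p) + (Dv - classical_gradient q) by rewrite opprD addrACA.
apply: (@le_lt_trans _ _ (normH1 Omega (u - p) (Du - classical_gradient p) +
  normH1 Omega (v - q) (Dv - classical_gradient q))).
  2: by rewrite (splitr e); exact: (ltrD hp hq).
rewrite !normH1E.
apply: (psd_triangle P1 (x := (u - p, Du - classical_gradient p))
  (y := (v - q, Dv - classical_gradient q))).
  split; [apply: (psd_SB Pv)|apply: (psd_SB Pt)] => //.
    by apply: testv_L2v; exact: Ctest.
  by apply: testv_L2t; exact: Ctest.
split; [apply: (psd_SB Pv)|apply: (psd_SB Pt)] => //.
  by apply: testv_L2v; exact: Ctest.
by apply: testv_L2t; exact: Ctest.
Qed.

Lemma approximable_Z (c : R) u Du :
  L2v Omega u -> L2t Omega Du ->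
  test_approximable C u Du -> test_approximable C (c *: u) (c *: Du).
Proof.
move=> Lu LDu au e e0.
(* Dividing by |c| + 1 instead of |c| covers c = 0. *)
have c1 : 0 < `|c| + 1 by rewrite ltr_wpDl.
have [p [Cp hp]] := au _ (divr_gt0 e0 c1).
have Lup : L2v Omega (u - p) by apply: (psd_SB Pv) => //; apply: testv_L2v; exact: Ctest.
have LDup : L2t Omega (Du - classical_gradient p).
  by apply: (psd_SB Pt) => //; apply: testv_L2t; exact: Ctest.
exists (c *: p); split; first exact: CZ.
rewrite classical_gradientZ; last exact: Ctest.
rewrite -!scalerBr /normH1 (psd_Zl Pv)//; last exact: (psd_SZ Pv).
rewrite (psd_Zr Pv)// (psd_Zl Pt)//; last exact: (psd_SZ Pt).
rewrite (psd_Zr Pt)// -!mulrDr mulrA -expr2 sqrtrM ?sqr_ge0// sqrtr_sqr.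
move: hp; rewrite ltr_pdivlMr// /normH1; apply: le_lt_trans.
by rewrite mulrC ler_wpM2l ?sqrtr_ge0// lerDl.
Qed.

End Approximable.

Lemma testvD phi psi : testv phi -> testv psi -> testv (phi + psi).
Proof. by move=> tp tq i; exact: test_D. Qed.

Lemma testvZ (c : R) phi : testv phi -> testv (c *: phi).
Proof. by move=> tp i; exact: test_Z. Qed.

Lemma divfree_D phi psi : divergence_free_test Omega phi ->
  divergence_free_test Omega psi -> divergence_free_test Omega (phi + psi).
Proof.
move=> [tp dp] [tq dq]; split; first exact: testvD.
move=> x; transitivity (\sum_i (partial i (phi i) x + partial i (psi i) x)).
  2: by rewrite big_split /= dp dq addr0.
apply: eq_bigr => i _.
by apply: partialD; [exact: test_derivable (tp i)|exact: test_derivable (tq i)].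
Qed.

Lemma divfree_Z (c : R) phi : divergence_free_test Omega phi ->
  divergence_free_test Omega (c *: phi).
Proof.
move=> [tp dp]; split; first exact: testvZ.
move=> x; transitivity (c * \sum_i partial i (phi i) x); last by rewrite dp mulr0.
rewrite mulr_sumr; apply: eq_bigr => i _.
by rewrite (_ : (c *: phi) i = c *: phi i)// (partialZ _ _ (tp i)).
Qed.

Lemma Vspace_L2v u Du : Vspace Omega u Du -> L2v Omega u.
Proof. by move=> [[[]]]. Qed.

Lemma Vspace_L2t u Du : Vspace Omega u Du -> L2t Omega Du.
Proof. by move=> [[[]]]. Qed.

Lemma Vspace_D u Du v Dv : Vspace Omega u Du -> Vspace Omega v Dv ->
  Vspace Omega (u + v) (Du + Dv).
Proof.
move=> Vu Vv; have Lu := Vspace_L2v Vu; have Lv := Vspace_L2v Vv.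
have LDu := Vspace_L2t Vu; have LDv := Vspace_L2t Vv.
case: Vu => -[Hu au] bu; case: Vv => -[Hv av] bv; split; [split|].
- exact: H1_D.
- by apply: (approximable_D (C := fun phi => testv phi)) => //; exact: testvD.
- apply: (approximable_D (C := divergence_free_test Omega)) => //; last exact: divfree_D.
  by move=> phi [].
Qed.

Lemma Vspace_Z (c : R) u Du : Vspace Omega u Du -> Vspace Omega (c *: u) (c *: Du).
Proof.
move=> Vu; have Lu := Vspace_L2v Vu; have LDu := Vspace_L2t Vu.
case: Vu => -[Hu au] bu; split; [split|].
- exact: H1_Z.
- by apply: (approximable_Z (C := fun phi => testv phi)) => //; exact: testvZ.
- apply: (approximable_Z (C := divergence_free_test Omega)) => //; last exact: divfree_Z.
  by move=> phi [].
Qed.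

Lemma Vspace_B u Du v Dv : Vspace Omega u Du -> Vspace Omega v Dv ->
  Vspace Omega (u - v) (Du - Dv).
Proof.
move=> Vu Vv; rewrite -(scaleN1r v) -(scaleN1r Dv).
exact: (Vspace_D Vu (Vspace_Z (-1) Vv)).
Qed.

Lemma normH1_0 : normH1 Omega 0 0 = 0.
Proof.
by rewrite /normH1 (psd_0l Pv (psd_S0 Pv)) (psd_0l Pt (psd_S0 Pt)) addr0 sqrtr0.
Qed.

Lemma Vspace_test phi : divergence_free_test Omega phi ->
  Vspace Omega phi (classical_gradient phi).
Proof.
move=> tp; have [tphi _] := tp; split; [split|].
- exact: H1_test.
- by move=> e e0; exists phi; split=> //; rewrite !subrr normH1_0.
- by move=> e e0; exists phi; split=> //; rewrite !subrr normH1_0.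
Qed.

Lemma Vspace_Hspace u Du : Vspace Omega u Du -> Hspace Omega u.
Proof.
move=> Vu; split; first exact: Vspace_L2v Vu.
move=> e e0; have [_ /(_ e e0) [phi [tp hp]]] := Vu.
exists phi; split => //; apply: le_lt_trans hp; rewrite ler_wsqrtr// lerDl.
apply: (psd_ge0 Pt); apply: (psd_SB Pt); first exact: Vspace_L2t Vu.
by apply: testv_L2t; case: tp.
Qed.

(** Subtracting the gradient of a divergence-free test field leaves the trace of Du unchanged and
    makes the gradient arbitrarily small in L^2, so Cauchy-Schwarz bounds the pairing by any
    multiple of e. *)
Lemma Vspace_trace0 u Du f : Vspace Omega u Du -> L2 Omega f ->
  \sum_i ip Omega f (Du i i) = 0.
Proof.
move=> Vu Lf; have LDu := Vspace_L2t Vu.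
pose tr := \sum_i Du i i.
have Ltr : L2 Omega tr by apply: (psd_S_sum P2) => i; exact: LDu.
have -> : \sum_i ip Omega f (Du i i) = ip Omega f tr.
  rewrite (psd_sym P2) (psd_suml P2)//; apply: eq_bigr => i _; exact: (psd_sym P2).
have bound (e : R) : 0 < e -> `|ip Omega f tr| <= 3 * Num.sqrt (ip Omega f f) * e.
  move=> e0; have [_ /(_ e e0) [phi [[tp dp] hp]]] := Vu.
  have LD := psd_SB Pt LDu (testv_L2t tp).
  have -> : tr = \sum_i (Du - classical_gradient phi) i i.
    rewrite /tr; apply/funext => x; rewrite !fct_sumE.
    transitivity (\sum_i Du i i x - \sum_i partial i (phi i) x); first by rewrite dp subr0.
    by rewrite -sumrB.
  rewrite (psd_sym P2) (psd_suml P2) => [|i|//]; last exact: LD.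
  apply: (le_trans (ler_norm_sum _ _ _)).
  have -> : 3 * Num.sqrt (ip Omega f f) * e = \sum_(i < 3) Num.sqrt (ip Omega f f) * e.
    by rewrite sumr_const card_ord -[RHS]mulr_natl mulrA.
  apply: ler_sum => i _; rewrite (psd_sym P2).
  apply: (le_trans (psd_cauchy_schwarz_sqrt P2 Lf (LD i i))).
  apply: ler_wpM2l; first exact: sqrtr_ge0.
  apply: le_trans (ltW hp); rewrite ler_wsqrtr//.
  apply: (@le_trans _ _ (ipt Omega (Du - classical_gradient phi) (Du - classical_gradient phi))).
    exact: (le_trans (psd_comp_le i P2 (LD i)) (psd_comp_le i Pv LD)).
  rewrite lerDr; apply: (psd_ge0 Pv); apply: (psd_SB Pv); first exact: Vspace_L2v Vu.
  exact: testv_L2v.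
apply/eqP; rewrite -normr_le0; apply/ler_addgt0Pl => e e0; rewrite addr0.
set s := Num.sqrt (ip Omega f f) in bound.
have s0 : 0 <= s by exact: sqrtr_ge0.
have d0 : 0 < 3 * s + 1 by rewrite ltr_wpDl// mulr_ge0.
apply: (le_trans (bound (e / (3 * s + 1)) (divr_gt0 e0 d0))).
by rewrite mulrCA ler_piMr ?(ltW e0)// ler_pdivrMr// mul1r lerDl.
Qed.

End VSpace.

(** * The trilinear form *)

Section Trilinear.
Context {R : realType} (Omega : set (R * R * R)).
Hypothesis mO : measurable (Omega : set (@R3 R)).
Hypothesis fO : (leb3 (Omega : set (@R3 R)) < +oo)%E.
Implicit Types (u v w z phi psi : @vector_field R) (Du Dv Dw Dz G : @tensor_field R).

Let P2 := L2_psd mO.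
Let Pv := L2v_psd mO.
Let Pt := L2t_psd mO.

Definition L4v u := L2v Omega u /\ L2 Omega (sqlen u).

(** Writing ((u . grad) v, w) as the L^2 product of w (x) u with Dv turns the trilinear form into a
    value of [ipt], to which the theory of forms applies. *)
Definition outer w u : @tensor_field R := fun i j x => w i x * u j x.

Lemma L4v_comp u i : L4v u -> L2 Omega (fun x => u i x ^+ 2).
Proof.
move=> [Lu [ms isq]].
have mi : measurable_fun (Omega : set (@R3 R)) (u i : @R3 R -> R) by case: (Lu i).
split; first exact: measurable_funX.
apply: (@le_integrable _ (@R3 R) R leb3 Omega mO _ _ _ _ isq).
  by apply/measurable_EFinP; do 2!apply: measurable_funX.
move=> x _; rewrite !abse_EFin lee_fin !ger0_norm ?sqr_ge0// lerXn2r ?nnegrE ?sqr_ge0 ?sqlen_ge0//.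
by rewrite /sqlen (bigD1 i)//= lerDl; apply: sumr_ge0 => j _; exact: sqr_ge0.
Qed.

Lemma outer_L2t w u : L4v w -> L4v u -> L2t Omega (outer w u).
Proof.
move=> Lw Lu i j; apply: (L2_mul mO); [by case: Lw|by case: Lu| |]; exact: L4v_comp.
Qed.

Lemma sqlen_sum u : sqlen u = \sum_i (fun x => u i x ^+ 2 : R).
Proof. by apply/funext => x; rewrite fct_sumE. Qed.

(** Pointwise, |w (x) u|^2 = |w|^2 |u|^2. *)
Lemma outer_norm w u : L4v w -> L4v u ->
  ipt Omega (outer w u) (outer w u) = ip Omega (sqlen w) (sqlen u).
Proof.
move=> Lw Lu; rewrite (sqlen_sum w) (psd_suml P2) => [|i|]; last 2 first.
- exact: L4v_comp.
- by case: Lu.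
apply: eq_bigr => i _; rewrite (psd_sym P2) sqlen_sum (psd_suml P2) => [|j|]; last 2 first.
- exact: L4v_comp.
- exact: L4v_comp.
apply: eq_bigr => j _; rewrite /ip; apply: eq_Rintegral => x _.
by rewrite /outer; ring.
Qed.

Lemma Rintegral_sum3 (F : 'I_3 -> R * R * R -> R) :
  (forall i, leb3.-integrable (Omega : set (@R3 R)) (fun x => (F i x)%:E)) ->
  \int[leb3]_(x in Omega) (\sum_i F i x) = \sum_i \int[leb3]_(x in Omega) F i x.
Proof.
move=> iF; rewrite !big_ord_recl !big_ord0 !addr0.
rewrite -(@RintegralD _ (@R3 R) R leb3 Omega _ _ mO (iF _) (iF _)).
have i2 : leb3.-integrable (Omega : set (@R3 R))
    (EFin \o (fun x => F (lift ord0 ord0) x + F (lift ord0 (lift ord0 ord0)) x)).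
  exact: (@integrableD _ (@R3 R) R leb3 Omega mO _ _ (iF _) (iF _)).
rewrite -(@RintegralD _ (@R3 R) R leb3 Omega _ _ mO (iF _) i2).
by apply: eq_Rintegral => x _; rewrite !big_ord_recl big_ord0 addr0.
Qed.

Lemma advectionE u Dv w : L4v u -> L2t Omega Dv -> L4v w ->
  ipv Omega (advection u Dv) w = ipt Omega (outer w u) Dv.
Proof.
move=> Lu LDv Lw; apply: eq_bigr => i _.
rewrite -Rintegral_sum3 => [|j].
  apply: eq_Rintegral => x _; rewrite /advection mulr_suml; apply: eq_bigr => j _.
  by rewrite /outer; ring.
by apply: (L2_mul_integrable mO); [exact: outer_L2t|exact: LDv].
Qed.

Lemma outerDl w1 w2 u : outer (w1 + w2) u = outer w1 u + outer w2 u.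
Proof. by do 3!apply/funext => ?; rewrite /outer !fctE mulrDl. Qed.

Lemma outerDr w u1 u2 : outer w (u1 + u2) = outer w u1 + outer w u2.
Proof. by do 3!apply/funext => ?; rewrite /outer !fctE mulrDr. Qed.

Section Ladyzhenskaya.
Variable b0 : R.
Hypothesis Lady : ladyzhenskaya_constant Omega b0.

Lemma Vspace_L4v u Du : Vspace Omega u Du -> L4v u.
Proof.
move=> Vu; split; first exact: Vspace_L2v Vu.
by have [] := ladyzhenskaya_L4 Lady Vu.
Qed.

Lemma normH1_ge u Du : Vspace Omega u Du ->
  normv Omega u <= normH1 Omega u Du /\ normt Omega Du <= normH1 Omega u Du.
Proof.
move=> Vu.
have u0 := psd_ge0 Pv (Vspace_L2v Vu); have d0 := psd_ge0 Pt (Vspace_L2t Vu).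
by split; rewrite ler_wsqrtr// ?lerDl ?lerDr.
Qed.

Lemma L4_le_H1 u Du : Vspace Omega u Du ->
  ip Omega (sqlen u) (sqlen u) <= (b0 * normH1 Omega u Du ^+ 2) ^+ 2.
Proof.
move=> Vu; have [_ h] := ladyzhenskaya_L4 Lady Vu; apply: (le_trans h).
have [nu nd] := normH1_ge Vu.
have n0 : 0 <= normv Omega u := sqrtr_ge0 _.
have d0 : 0 <= normt Omega Du := sqrtr_ge0 _.
move: (normH1 Omega u Du) (normv Omega u) (normt Omega Du) nu nd n0 d0 => H n d nH dH n0 d0.
rewrite -mulrA exprMn ler_wpM2l ?sqr_ge0// -exprM (exprS H 3).
by apply: ler_pM => //; [rewrite exprn_ge0|rewrite lerXn2r ?nnegrE ?(le_trans d0 dH)].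
Qed.

Lemma outer_bound w Dw u Du : Vspace Omega w Dw -> Vspace Omega u Du ->
  normt Omega (outer w u) <= b0 * normH1 Omega w Dw * normH1 Omega u Du.
Proof.
move=> Vw Vu; have Lw := Vspace_L4v Vw; have Lu := Vspace_L4v Vu.
have b00 : 0 <= b0 by case: Lady => /ltW.
have Hw : 0 <= normH1 Omega w Dw := sqrtr_ge0 _.
have Hu : 0 <= normH1 Omega u Du := sqrtr_ge0 _.
rewrite /normt outer_norm//.
have := psd_cauchy_schwarz P2 (proj2 Lw) (proj2 Lu).
have q0 := psd_ge0 P2 (proj2 Lw); have r0 := psd_ge0 P2 (proj2 Lu).
have := L4_le_H1 Vw; have := L4_le_H1 Vu.
have p0 : 0 <= ip Omega (sqlen w) (sqlen u).
  by apply: Rintegral_ge0 => x _; rewrite mulr_ge0 ?sqlen_ge0.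
move: (ip _ _ _) (ip _ _ _) (ip _ _ _) q0 r0 p0 => p q r q0 r0 p0.
move: (normH1 Omega w Dw) (normH1 Omega u Du) Hw Hu => a c a0 c0 h1 h2 h3.
rewrite -(@ger0_norm _ (b0 * a * c)) ?mulr_ge0// -sqrtr_sqr ler_wsqrtr//.
have B0 : 0 <= (b0 * a * c) ^+ 2 by exact: sqr_ge0.
rewrite -(ler_sqr p0 B0); apply: (le_trans h3).
have -> : ((b0 * a * c) ^+ 2) ^+ 2 = (b0 * a ^+ 2) ^+ 2 * (b0 * c ^+ 2) ^+ 2 by ring.
exact: ler_pM.
Qed.

(** A crude bound, for passing to limits and for the local boundedness of the right-hand side; the
    decay rate relies on [trilinear_sharp]. *)
Lemma trilinear_bound w Dw u Du G : Vspace Omega w Dw -> Vspace Omega u Du ->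
  L2t Omega G -> `|ipt Omega (outer w u) G| <=
    b0 * normH1 Omega w Dw * normH1 Omega u Du * normt Omega G.
Proof.
move=> Vw Vu LG.
apply: (le_trans (psd_cauchy_schwarz_sqrt Pt (outer_L2t (Vspace_L4v Vw) (Vspace_L4v Vu)) LG)).
by apply: ler_wpM2r; [exact: sqrtr_ge0|exact: outer_bound].
Qed.

(** psi_i d_j psi_i = d_j (psi_i^2) / 2, and psi_i^2 is a test function: the weak derivative moves
    d_j onto u_j, and summing over j yields psi_i^2 against tr Du = 0. *)
Lemma trilinear_test0 u Du psi : Vspace Omega u Du ->
  (forall i, test_function Omega (psi i)) ->
  ipt Omega (outer psi u) (classical_gradient psi) = 0.
Proof.
move=> Vu tp; have Lu := Vspace_L4v Vu.
have [[[_ _ wu] _] _] := Vu.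
rewrite /ipt big1// => i _.
have tpp := test_M (tp i) (tp i).
have tr := Vspace_trace0 mO fO Vu (test_L2 mO fO tpp).
have E j : ip Omega (outer psi u i j) (classical_gradient psi i j) =
    - (1 / 2) * ip Omega (psi i * psi i) (Du j j).
  rewrite (psd_sym P2 (psi i * psi i)).
  have := wu j j _ tpp => /eqP; rewrite eq_sym eqr_oppLR => /eqP ->.
  rewrite mulrNN.
  rewrite -(psd_Zr P2 (1 / 2)); last 2 first.
  - exact: (test_L2 mO fO (test_partial j tpp)).
  - exact: (proj1 Lu).
  rewrite /ip; apply: eq_Rintegral => x _.
  rewrite /outer /classical_gradient
    -[X in _ = _ * X]/((1 / 2) * partial j (psi i * psi i) x) partialM;
    [|exact: test_derivable (tp i)..].
  by field.
under eq_bigr do rewrite E.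
by rewrite -mulr_sumr tr mulr0.
Qed.

(** Extends the cancellation from test fields to V by density, z being approximated in both of its
    occurrences. *)
Lemma trilinear0 u Du z Dz : Vspace Omega u Du -> Vspace Omega z Dz ->
  ipt Omega (outer z u) Dz = 0.
Proof.
move=> Vu Vz; have [_ az] := Vz.
have Lu := Vspace_L4v Vu; have Lz := Vspace_L4v Vz; have LDz := Vspace_L2t Vz.
have b00 : 0 <= b0 by case: Lady => /ltW.
have Hu0 : 0 <= normH1 Omega u Du := sqrtr_ge0 _.
have Hz0 : 0 <= normH1 Omega z Dz := sqrtr_ge0 _.
pose K := b0 * normH1 Omega u Du * (2 * normH1 Omega z Dz + 1).
have K0 : 0 <= K by rewrite /K !mulr_ge0// addr_ge0// mulr_ge0.
(* Two of the three error terms are linear in the distance from z to psi and one is quadratic; e <=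
   1 makes the latter linear, which explains the + 1 in [K]. *)
have bound (e : R) : 0 < e -> e <= 1 -> `|ipt Omega (outer z u) Dz| <= K * e.
  move=> e0 e1; have [psi [dpsi hpsi]] := az _ e0.
  have Vp := Vspace_test mO fO dpsi.
  have Vd := Vspace_B mO fO Vz Vp.
  set d := z - psi in Vd hpsi; set Dd := Dz - classical_gradient psi in Vd hpsi.
  have Lp := Vspace_L4v Vp; have Ld := Vspace_L4v Vd.
  have LDp := Vspace_L2t Vp; have LDd := Vspace_L2t Vd.
  have [tp _] := dpsi.
  have T0 := trilinear_test0 Vu tp.
  have zE : z = psi + d by rewrite /d addrC subrK.
  have DzE : Dz = classical_gradient psi + Dd by rewrite /Dd addrC subrK.
  (* Expansion around psi, whose own contribution is 0. *)
  have -> : ipt Omega (outer z u) Dz =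
      ipt Omega (outer d u) Dz + ipt Omega (outer z u) Dd - ipt Omega (outer d u) Dd.
    have Oz := outer_L2t Lz Lu; have Od := outer_L2t Ld Lu; have Op := outer_L2t Lp Lu.
    have e1' : ipt Omega (outer z u) Dz = ipt Omega (outer psi u) Dz + ipt Omega (outer d u) Dz.
      by rewrite {1}zE outerDl (psd_Dl Pt).
    have e2 : ipt Omega (outer psi u) Dz = ipt Omega (outer psi u) Dd.
      by rewrite {1}DzE (psd_Dr Pt)// T0 add0r.
    have e3 : ipt Omega (outer z u) Dd = ipt Omega (outer psi u) Dd + ipt Omega (outer d u) Dd.
      by rewrite {1}zE outerDl (psd_Dl Pt).
    by rewrite e1' e2 e3; ring.
  have [nd ndd] := normH1_ge Vd; have [nz ndz] := normH1_ge Vz.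
  have B1 := trilinear_bound Vd Vu LDz.
  have B2 := trilinear_bound Vz Vu LDd.
  have B3 := trilinear_bound Vd Vu LDd.
  have g0 : 0 <= normt Omega Dz := sqrtr_ge0 _.
  have gd0 : 0 <= normt Omega Dd := sqrtr_ge0 _.
  have Hd0 : 0 <= normH1 Omega d Dd := sqrtr_ge0 _.
  apply: (le_trans (ler_normB _ _)); apply: (le_trans (lerD (ler_normD _ _) (lexx _))).
  apply: (le_trans (lerD (lerD B1 B2) B3)).
  rewrite /K; clear B1 B2 B3 zE DzE T0 Vd Vp Ld LDd Lp LDp.
  move: (normH1 Omega d Dd) (normt Omega Dd) (normt Omega Dz) (normH1 Omega u Du)
    (normH1 Omega z Dz) hpsi nd ndd nz ndz g0 gd0 Hd0 Hu0 Hz0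
    => Hd gd g Hu Hz hd _ gdH _ gH g0 gd0 Hd0 Hu0 Hz0.
  have A : Hd * g + Hz * gd + Hd * gd <= (2 * Hz + 1) * e.
    have h1 : Hd * g <= e * Hz by apply: ler_pM => //; exact: ltW.
    have h2 : Hz * gd <= Hz * e by apply: ler_pM => //; exact: le_trans gdH (ltW hd).
    have h3 : Hd * gd <= e * 1.
      by apply: ler_pM => //; [exact: ltW|exact: le_trans gdH (le_trans (ltW hd) e1)].
    lra.
  have -> : b0 * Hd * Hu * g + b0 * Hz * Hu * gd + b0 * Hd * Hu * gd =
    b0 * Hu * (Hd * g + Hz * gd + Hd * gd) by ring.
  by rewrite -[leRHS]mulrA ler_wpM2l// mulr_ge0.
apply/eqP; rewrite -normr_le0; apply/ler_addgt0Pl => e e0; rewrite addr0.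
have K1 : 0 < K + 1 by rewrite ltr_wpDl.
have [h|h] := leP (e / (K + 1)) 1.
  apply: (le_trans (bound _ (divr_gt0 e0 K1) h)).
  by rewrite mulrCA ler_piMr ?(ltW e0)// ler_pdivrMr// mul1r lerDl.
(* Here e > K + 1, so the bound at 1 is enough. *)
apply: (le_trans (bound 1 ltr01 (lexx _))); rewrite mulr1.
by move: h; rewrite ltr_pdivlMr// mul1r => h; apply: le_trans (ltW h); rewrite lerDl.
Qed.

(** The scalar [s] times the identity matrix; for s = |z|^2 / 3 it is the trace part of z (x) z. *)
Definition iso (s : @scalar_field R) : @tensor_field R :=
  fun i j => (i == j)%:R *: s.

Lemma iso_L2t s : L2 Omega s -> L2t Omega (iso s).
Proof. by move=> Ls i j; exact: (psd_SZ P2). Qed.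

Lemma ipt_iso s G : L2 Omega s -> L2t Omega G ->
  ipt Omega (iso s) G = \sum_i ip Omega s (G i i).
Proof.
move=> Ls LG; apply: eq_bigr => i _; rewrite (bigD1 i)//= big1 => [|j ji].
  by rewrite /iso eqxx scale1r addr0.
rewrite /iso eq_sym (negbTE ji) scale0r; exact: (psd_0l P2 (LG i j)).
Qed.

(* As tr Dv = 0, only the trace-free part of z (x) z contributes, and its
   squared length is 2/3 |z|^4. *)
Lemma trilinear_sharp z Dz v Dv : Vspace Omega z Dz -> Vspace Omega v Dv ->
  ipt Omega (outer z z) Dv ^+ 2 <=
  2 / 3 * (b0 ^+ 2 * normv Omega z * normt Omega Dz ^+ 3) * normt Omega Dv ^+ 2.
Proof.
move=> Vz Vv; have Lz := Vspace_L4v Vz; have LDv := Vspace_L2t Vv.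
have [_ lz] := ladyzhenskaya_L4 Lady Vz.
have Oz := outer_L2t Lz Lz.
have Ls := proj2 Lz; have Li := iso_L2t Ls.
have Li3 := psd_SZ Pt (1 / 3) Li.
pose T := outer z z - (1 / 3) *: iso (sqlen z).
have LT : L2t Omega T by exact: (psd_SB Pt).
have E1 : ipt Omega (outer z z) Dv = ipt Omega T Dv.
  by rewrite (psd_Bl Pt)// (psd_Zl Pt)// ipt_iso// (Vspace_trace0 mO fO Vv Ls) mulr0 subr0.
have E2 : ipt Omega T T = 2 / 3 * ip Omega (sqlen z) (sqlen z).
  rewrite /T (psd_Bl Pt)// !(psd_Br Pt)// !(psd_Zl Pt)// !(psd_Zr Pt)//.
  rewrite outer_norm// (psd_sym Pt (outer z z)) !ipt_iso//.
  have -> : \sum_i ip Omega (sqlen z) (outer z z i i) = ip Omega (sqlen z) (sqlen z).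
    transitivity (ip Omega (\sum_i (fun x => z i x ^+ 2 : R)) (sqlen z)).
      2: by rewrite -sqlen_sum.
    rewrite (psd_suml P2) => [|i|//]; last exact: L4v_comp.
    by apply: eq_bigr => i _; rewrite (psd_sym P2); congr ip.
  have -> : \sum_i ip Omega (sqlen z) (iso (sqlen z) i i) = 3 * ip Omega (sqlen z) (sqlen z).
    under eq_bigr do rewrite /iso eqxx scale1r.
    by rewrite sumr_const card_ord -[LHS]mulr_natl.
  by field.
rewrite E1; apply: (le_trans (psd_cauchy_schwarz Pt LT LDv)).
rewrite E2 /normt sqr_sqrtr ?(psd_ge0 Pt)//.
by apply: ler_wpM2r; [exact: (psd_ge0 Pt)|apply: ler_wpM2l].
Qed.

End Ladyzhenskaya.
End Trilinear.

(** * Differentiation of the energy, Gronwall and Bessel *)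

Section Abstract.
Context {R : realType}.

(** Meant for the remainder of the energy around a frozen state; the bound at s = t also forces q t
    = 0. *)
Lemma is_derive_quadratic0 (q : R -> R) (t K : R) :
  (\forall s \near t, `|q s| <= K * (s - t) ^+ 2) -> is_derive t (1 : R) q 0.
Proof.
move=> H.
have qt : q t = 0.
  have := nbhs_singleton H; rewrite subrr expr0n /= mulr0.
  by rewrite normr_le0 => /eqP.
have C : (h^-1 *: ((q \o shift t) (h *: (1 : R)) - q t)) @[h --> (0 : R)^'] --> (0 : R).
  have cv0 : (fun h : R => K * h) h @[h --> (0 : R)^'] --> (0 : R).
    rewrite -[X in _ --> X](mulr0 K); apply: cvgMl_tmp; exact: nbhs_dnbhs.
  have H0 : \forall h \near (0 : R), `|q (h + t)| <= K * h ^+ 2.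
    have [e /= e0 he] := H; exists e => //= h hh.
    have := he (h + t); rewrite /ball_ /= addrK; apply.
    by rewrite opprD addrCA subrr addr0 normrN; rewrite /ball_ /= sub0r normrN in hh.
  apply/cvgr0Pnorm_le => e e0.
  move/cvgr0Pnorm_le : cv0 => /(_ e e0) C1.
  have H1 := nbhs_dnbhs H0.
  near=> h.
  have h1 : `|K * h| <= e by near: h.
  have h2 : `|q (h + t)| <= K * h ^+ 2 by near: h.
  have hn : h != 0 by near: h; exact: nbhs_dnbhs_neq.
  rewrite /shift /= qt subr0 [h%:A]mulr1 normrZ normfV.
  apply: le_trans h1.
  rewrite ler_pdivrMl ?normr_gt0//; apply: (le_trans h2).
  rewrite normrM; have -> : h ^+ 2 = `|h| ^+ 2 by rewrite real_normK// num_real.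
  rewrite [leRHS]mulrCA -expr2 ler_wpM2r ?sqr_ge0//; exact: ler_norm.
split; first by apply/cvg_ex; exists 0.
exact: cvg_lim C.
Unshelve. all: end_near. Qed.

(** With the integrating factor, exp(k s) (E - c / k) is nonincreasing. The mean value theorem
    replaces integration, as [dE] is not assumed continuous. *)
Lemma gronwall (E dE : R -> R) (k c t0 : R) : 0 < k -> 0 <= c ->
  (forall s, t0 <= s -> is_derive s (1 : R) E (dE s)) ->
  (forall s, t0 <= s -> dE s <= c - k * E s) ->
  forall t, t0 <= t -> E t <= expR (- k * (t - t0)) * E t0 + c / k.
Proof.
move=> k0 c0 DE bE t; rewrite le_eqVlt => /predU1P[<-|tt].
  by rewrite subrr mulr0 expR0 mul1r lerDl divr_ge0// ltW.
pose G s := expR (k * s) * (E s - c / k).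
have DG s : t0 <= s -> is_derive s (1 : R) G (expR (k * s) * (k * E s - c + dE s)).
  move=> ts; have := DE s ts => DEs.
  apply: is_derive_eq.
  rewrite /GRing.scale /=; field; exact: lt0r_neq0.
have [||x xin Gx] := @MVT R G (fun s => expR (k * s) * (k * E s - c + dE s)) t0 t tt.
- by move=> x; rewrite in_itv /= => /andP[/ltW h _]; exact: DG.
- apply: continuous_in_subspaceT => x; rewrite inE /= in_itv /= => /andP[h _].
  by apply: differentiable_continuous; apply/derivable1_diffP; case: (DG x h).
have tx : t0 <= x by move: xin; rewrite in_itv /= => /andP[/ltW].
have : G t <= G t0.
  rewrite -subr_le0 Gx; apply: mulr_le0_ge0; last by rewrite subr_ge0 ltW.
  by apply: mulr_ge0_le0; [exact: expR_ge0|have := bE x tx; lra].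
rewrite /G => H.
have H2 : E t - c / k <= expR (- k * (t - t0)) * (E t0 - c / k).
  rewrite -(ler_pM2l (expR_gt0 (k * t))); apply: (le_trans H).
  rewrite mulrA -expRD (_ : k * t + - k * (t - t0) = k * t0)//; ring.
have e0 := expR_ge0 (- k * (t - t0)).
have ck : 0 <= c / k by rewrite divr_ge0// ltW.
have := mulr_ge0 e0 ck; lra.
Qed.

Section Energy.
Context (V : lmodType R) (S T : V -> Prop) (a : V -> V -> R).
Hypothesis Pa : psd_form S a.
Hypothesis TS : forall x, T x -> S x.
Hypothesis TB : forall x y, T x -> T y -> T (x - y).
Variables (z : R -> V) (F : R -> V -> R).
Hypothesis zT : forall s : R, 0 < s -> T (z s).
Hypothesis zD : forall (s : R) x, 0 < s -> T x -> is_derive s (1 : R) (fun r => a (z r) x) (F s x).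

(* Testing the difference of two states against itself shows that z is locally
   Lipschitz for the seminorm of a. *)
Lemma energy_lipschitz (M t s : R) : 0 < t -> 0 < s -> t != s ->
  (forall (r : R) x, Num.min t s <= r <= Num.max t s -> T x -> `|F r x| <= M * Num.sqrt (a x x)) ->
  a (z s - z t) (z s - z t) <= M ^+ 2 * (s - t) ^+ 2.
Proof.
move=> t0 s0 ts bF; set d := z s - z t.
have Td : T d by apply: TB; exact: zT.
have [Sd Szs Szt] : [/\ S d, S (z s) & S (z t)] by split; apply: TS => //; exact: zT.
have [r r1 Er] : exists2 r, Num.min t s <= r <= Num.max t s & a d d = F r d * (s - t).
  have mv (x y : R) : 0 < x -> x < y -> exists2 r, x <= r <= y &
      a (z y) d - a (z x) d = F r d * (y - x).
    move=> x0 xy.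
    have [||r rin Er] := @MVT R (fun r => a (z r) d) (fun r => F r d) x y xy.
    - by move=> r; rewrite in_itv /= => /andP[h _]; apply: zD => //; exact: lt_trans h.
    - apply: continuous_in_subspaceT => r; rewrite inE /= in_itv /= => /andP[h _].
      apply: differentiable_continuous; apply/derivable1_diffP.
      by case: (zD (lt_le_trans x0 h) Td).
    by exists r => //; move: rin; rewrite in_itv /= => /andP[/ltW -> /ltW ->].
  have [h|h|/eqP h] := ltgtP t s; last by rewrite h in ts.
    have [r hr Er] := mv _ _ t0 h; exists r.
      by move: hr; rewrite /Num.min /Num.max; case: ltgtP h.
    by rewrite -Er -(psd_Bl Pa).
  have [r hr Er] := mv _ _ s0 h; exists r.
    by move: hr; rewrite /Num.min /Num.max; case: ltgtP h.
  rewrite -(opprB t s) mulrN -Er -(psd_Bl Pa)// -(psd_Nl Pa) ?opprB//.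
  exact: (psd_SB Pa).
have := bF r d r1 Td.
have A0 := psd_ge0 Pa Sd; set A := a d d in Er A0 *.
have q0 := sqrtr_ge0 A; have qA : Num.sqrt A ^+ 2 = A by exact: sqr_sqrtr.
move: (Num.sqrt A) q0 qA => q q0 qA bd.
have : q ^+ 2 <= M * q * `|s - t|.
  rewrite qA -(ger0_norm A0) Er normrM; apply: ler_wpM2r => //.
move=> h; rewrite -qA.
have [->|qn] := eqVneq q 0; first by rewrite expr0n /= -exprMn sqr_ge0.
have qp : 0 < q by rewrite lt0r qn.
have : q <= M * `|s - t|.
  by rewrite -(ler_pM2l qp) -expr2; apply: (le_trans h); rewrite mulrCA mulrA.
rewrite -[(s - t) ^+ 2]real_normK ?num_real// -exprMn => hq.
by rewrite lerXn2r// nnegrE// (le_trans q0 hq).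
Qed.

(** a(z s, z s) = 2 a(z s, z t) - a(z t, z t) + a(z s - z t, z s - z t): the first term is
    differentiable by hypothesis, and the last is quadratic in s - t by the Lipschitz bound. *)
Lemma energy_derive (t M e : R) : 0 < t -> 0 < e ->
  (forall (r : R) x, `|r - t| < e -> 0 < r -> T x -> `|F r x| <= M * Num.sqrt (a x x)) ->
  is_derive t (1 : R) (fun s => a (z s) (z s)) (2 * F t (z t)).
Proof.
move=> t0 e0 bF.
have Tt := zT t0; have St := TS Tt.
pose q s := a (z s - z t) (z s - z t).
(* Bilinearity is available only for s > 0, where z s lies in the domain. Elsewhere the remainder is
   defined by its expansion, so that the identity holds for every s. *)
pose q' s := if 0 < s then q s else a (z s) (z s) - 2 * a (z s) (z t) + a (z t) (z t).
have EE : (fun s => a (z s) (z s)) = (fun s => 2 * a (z s) (z t)) + (fun=> - a (z t) (z t)) + q'.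
  apply/funext => s; rewrite !fctE /q'; case: ifPn => [s0|_]; last by ring.
  have Ss := TS (zT s0).
  rewrite /q (psd_Bl Pa)//; last exact: (psd_SB Pa).
  by rewrite !(psd_Br Pa)// (psd_sym Pa (z t) (z s)); ring.
have dq : is_derive t (1 : R) q' 0.
  apply: (@is_derive_quadratic0 _ _ (M ^+ 2)).
  near=> s.
  have s0 : 0 < s by near: s; exact: lt_nbhsr.
  rewrite /q' s0 /q.
  have [<-|ts] := eqVneq t s.
    by rewrite !subrr (psd_0l Pa (psd_S0 Pa)) normr0 expr0n /= mulr0.
  rewrite ger0_norm; last by apply: (psd_ge0 Pa); apply: (psd_SB Pa) => //; exact: TS (zT s0).
  apply: energy_lipschitz => // r x hr Tx; apply: bF => //.
    have se : `|s - t| < e.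
      by near: s; apply/nbhs_ballP; exists e => //= s; rewrite /ball /= distrC.
    apply: le_lt_trans se; move: hr; rewrite /Num.min /Num.max.
    case: ltgtP ts => // h _ /andP[h1 h2].
      by rewrite !ger0_norm ?lerB// subr_ge0// ltW.
    by rewrite distrC (distrC s) !ger0_norm ?lerB// subr_ge0// ltW.
  by case/andP: hr => + _; apply: lt_le_trans; rewrite lt_min t0.
have d1 := zD t0 Tt.
rewrite EE; apply: is_derive_eq.
by rewrite /GRing.scale /=; ring.
Unshelve. all: end_near. Qed.

End Energy.

(** The squared norms [m k] are left free so that the same coefficients serve the eigenfunctions in
    L^2, with m = 1, and their gradients, with m = lam. *)
Lemma psd_bessel (V : lmodType R) (S : V -> Prop) (a : V -> V -> R) (e : nat -> V)
    (m c : nat -> R) (z : V) (n : nat) : psd_form S a ->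
  (forall k, S (e k)) -> S z ->
  (forall k l, a (e k) (e l) = m k * (k == l)%:R) ->
  (forall k, a (e k) z = m k * c k) ->
  let P := \sum_(k < n) c k *: e k in
  a (z - P) (z - P) = a z z - \sum_(k < n) m k * c k ^+ 2.
Proof.
move=> Pa Se Sz ae az P.
have SP : S P by apply: (psd_S_sum Pa) => k; exact: (psd_SZ Pa).
have Pl x : S x -> a P x = \sum_(k < n) c k * a (e k) x.
  move=> Sx; rewrite (psd_suml Pa)//; last by move=> k; exact: (psd_SZ Pa).
  by apply: eq_bigr => k _; rewrite (psd_Zl Pa).
have aPz : a P z = \sum_(k < n) m k * c k ^+ 2.
  by rewrite Pl//; apply: eq_bigr => k _; rewrite az; ring.
have aPP : a P P = \sum_(k < n) m k * c k ^+ 2.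
  rewrite Pl//; apply: eq_bigr => k _; rewrite (psd_sym Pa) Pl// (bigD1 k)//= big1.
    by rewrite ae eqxx mulr1; ring.
  by move=> l lk; rewrite ae (_ : (l == k :> nat) = false) ?mulr0//; apply/negbTE.
rewrite (psd_Bl Pa)//; last exact: (psd_SB Pa).
by rewrite !(psd_Br Pa)// (psd_sym Pa z P) aPz aPP; ring.
Qed.

End Abstract.

(** * Stokes eigenfunctions *)

Section DomainMeasure.
Context {R : realType} (Omega : set (R * R * R)).

Lemma domain_measurable : smooth_bounded_domain Omega ->
  measurable (Omega : set (@R3 R)).
Proof. by case=> _ oO _ _ _; exact: open_measurable3. Qed.

Lemma domain_finite_measure : smooth_bounded_domain Omega ->
  (leb3 (Omega : set (@R3 R)) < +oo)%E.
Proof.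
move=> dO; have mO := domain_measurable dO; case: dO => _ _ _ [M [_ bM]] _.
apply: le_lt_trans (leb3_ball_fin (`|M| + 2)).
apply: (@le_measure _ _ _ (leb3 : {measure set (@R3 R) -> \bar R})); rewrite ?inE//.
  exact: measurable_normball.
move=> x Ox /=; apply: (@le_lt_trans _ _ (`|M| + 1)).
  by apply: (bM (`|M| + 1)) => //; have := ler_norm M; lra.
by rewrite ltrD2l ltr1n.
Qed.

End DomainMeasure.

Section Modes.
Context {R : realType} (Omega : set (R * R * R)).
Hypothesis mO : measurable (Omega : set (@R3 R)).
Hypothesis fO : (leb3 (Omega : set (@R3 R)) < +oo)%E.
Variables (lam : nat -> R) (w : nat -> @vector_field R) (Dw : nat -> @tensor_field R).
Hypothesis HE : stokes_eigenbasis Omega lam w Dw.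
Implicit Types (z phi : @vector_field R) (Dz Dphi : @tensor_field R).

Let Pv := L2v_psd mO.
Let Pt := L2t_psd mO.

Lemma eigen_Vspace k : Vspace Omega (w k) (Dw k).
Proof. by case: (eigen_stokes HE k). Qed.

Lemma eigen_L2v k : L2v Omega (w k).
Proof. exact: Vspace_L2v (eigen_Vspace k). Qed.

Lemma eigen_L2t k : L2t Omega (Dw k).
Proof. exact: Vspace_L2t (eigen_Vspace k). Qed.

Lemma modesE n z : modes Omega w n z = \sum_(k < n) ipv Omega z (w k) *: w k.
Proof.
apply/funext => i; apply/funext => x; rewrite /modes !fct_sumE.
by apply: eq_bigr.
Qed.

Lemma modes_L2v n z : L2v Omega (modes Omega w n z).
Proof.
rewrite modesE; apply: (psd_S_sum Pv) => k; apply: (psd_SZ Pv); exact: eigen_L2v.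
Qed.

Lemma eigen_weak k phi Dphi : Vspace Omega phi Dphi ->
  ipt Omega (Dw k) Dphi = lam k * ipv Omega (w k) phi.
Proof.
move=> Vp; have [_ _ /(_ _ _ Vp) ->] := eigen_stokes HE k.
rewrite -(psd_Zl Pv) //; [exact: eigen_L2v|exact: Vspace_L2v Vp].
Qed.

Lemma modes_bessel n z : L2v Omega z ->
  ipv Omega (z - modes Omega w n z) (z - modes Omega w n z) =
  ipv Omega z z - \sum_(k < n) ipv Omega z (w k) ^+ 2.
Proof.
move=> Lz; rewrite modesE.
rewrite (@psd_bessel _ _ _ _ w (fun=> 1) (fun k => ipv Omega z (w k)) _ _ Pv)//.
- by congr (_ - _); apply: eq_bigr => k _; rewrite mul1r.
- exact: eigen_L2v.
- by move=> k l; rewrite mul1r (eigen_orthonormal HE).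
- by move=> k; rewrite mul1r (psd_sym Pv).
Qed.

Lemma ipv_modes n z phi : L2v Omega phi ->
  ipv Omega (modes Omega w n z) phi =
  \sum_(k < n) ipv Omega z (w k) * ipv Omega (w k) phi.
Proof.
move=> Lp; rewrite modesE (psd_suml Pv)//.
  by apply: eq_bigr => k _; rewrite (psd_Zl Pv)//; exact: eigen_L2v.
by move=> k; apply: (psd_SZ Pv); exact: eigen_L2v.
Qed.

Lemma normv_modes_le n z : L2v Omega z ->
  normv Omega (modes Omega w n z) <= normv Omega z.
Proof.
move=> Lz; rewrite /normv ler_wsqrtr//.
have Lm := modes_L2v n z.
rewrite -subr_ge0.
have -> : ipv Omega z z - ipv Omega (modes Omega w n z) (modes Omega w n z) =
    ipv Omega (z - modes Omega w n z) (z - modes Omega w n z).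
  rewrite modes_bessel// ipv_modes//; congr (_ - _); apply: eq_bigr => k _.
  rewrite expr2; congr (_ * _); rewrite (psd_sym Pv) ipv_modes; last exact: eigen_L2v.
  rewrite (bigD1 k)//= (eigen_orthonormal HE) eqxx mulr1 big1 ?addr0// => l lk.
  by rewrite (eigen_orthonormal HE) (_ : (l == k :> nat) = false) ?mulr0//; apply/negbTE.
by apply: (psd_ge0 Pv); exact: (psd_SB Pv).
Qed.

(** By [eigen_weak] the gradients [Dw k] are orthogonal with squared norms [lam k], and Dz has along
    them the coefficients of z along [w k]. *)
Lemma dirichlet_bessel n z Dz : Vspace Omega z Dz ->
  \sum_(k < n) lam k * ipv Omega z (w k) ^+ 2 <= ipt Omega Dz Dz.
Proof.
move=> Vz; have LDz := Vspace_L2t Vz.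
rewrite -subr_ge0.
rewrite -(@psd_bessel _ _ _ _ Dw lam (fun k => ipv Omega z (w k)) _ _ Pt)//.
- apply: (psd_ge0 Pt); apply: (psd_SB Pt) => //; apply: (psd_S_sum Pt) => k.
  by apply: (psd_SZ Pt); exact: eigen_L2t.
- exact: eigen_L2t.
- by move=> k l; rewrite (eigen_weak _ (eigen_Vspace l)) (eigen_orthonormal HE).
- by move=> k; rewrite (eigen_weak _ Vz) (psd_sym Pv).
Qed.

(** In the Bessel inequality for Dz the modes N <= k < n have weight at least [lam N], and L^2
    completeness makes the part of |z|^2 beyond n less than e / lam N. As indices start at 0,
    [lam N] is lambda_(N+1), and N = 0 gives the Poincare inequality. *)
Lemma poincare_modes N z Dz : Vspace Omega z Dz ->
  lam N * (ipv Omega z z - \sum_(k < N) ipv Omega z (w k) ^+ 2) <= ipt Omega Dz Dz.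
Proof.
move=> Vz; have Lz := Vspace_L2v Vz.
have lN : 0 < lam N := eigen_gt0 HE N.
apply/ler_addgt0Pl => e e0.
have r0 : 0 < Num.sqrt (e / lam N) by rewrite sqrtr_gt0 divr_gt0.
have /cvgr0Pnorm_lt /(_ _ r0) [n0 _ Hn] := eigen_complete HE (Vspace_Hspace mO fO Vz).
pose n := maxn n0 N.
have := Hn n (leq_maxl _ _); rewrite /= ger0_norm ?sqrtr_ge0// /normv ltr_sqrt ?divr_gt0//.
rewrite modes_bessel// ltr_pdivlMr// mulrC => hn.
have Nn : (N <= n)%N by exact: leq_maxr.
have := dirichlet_bessel n Vz.
rewrite -(big_mkord xpredT (fun k => lam k * ipv Omega z (w k) ^+ 2)).
rewrite (big_cat_nat _ (n := N))//=.
move: hn; rewrite -(big_mkord xpredT (fun k => ipv Omega z (w k) ^+ 2)).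
rewrite (big_cat_nat _ (n := N))//= => hn.
rewrite -(big_mkord xpredT (fun k => ipv Omega z (w k) ^+ 2)).
have h1 : 0 <= \sum_(0 <= k < N) lam k * ipv Omega z (w k) ^+ 2.
  by apply: sumr_ge0 => k _; rewrite mulr_ge0 ?sqr_ge0// ltW// (eigen_gt0 HE).
have h2 : lam N * \sum_(N <= k < n) ipv Omega z (w k) ^+ 2 <=
    \sum_(N <= k < n) lam k * ipv Omega z (w k) ^+ 2.
  rewrite mulr_sumr big_nat [leRHS]big_nat; apply: ler_sum => k /andP[Nk _].
  by rewrite ler_wpM2r ?sqr_ge0// (eigen_nondecreasing HE).
move: hn h1 h2; move: (ipv Omega z z) (ipt Omega Dz Dz) => a b.
move: (\sum_(0 <= k < N) _) (\sum_(N <= k < n) _) (\sum_(0 <= k < N) _) (\sum_(N <= k < n) _).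
by move=> p q r s; rewrite !mulrBr mulrDr; lra.
Qed.

Lemma poincare z Dz : Vspace Omega z Dz ->
  lam 0%N * normv Omega z ^+ 2 <= normt Omega Dz ^+ 2.
Proof.
move=> Vz; have := poincare_modes 0 Vz.
rewrite big_ord0 subr0 /normv /normt !sqr_sqrtr//.
  exact: (psd_ge0 Pt (Vspace_L2t Vz)).
exact: (psd_ge0 Pv (Vspace_L2v Vz)).
Qed.

End Modes.

(** * Weak solutions *)

Section Solutions.
Context {R : realType} (Omega : set (R * R * R)).
Hypothesis mO : measurable (Omega : set (@R3 R)).
Hypothesis fO : (leb3 (Omega : set (@R3 R)) < +oo)%E.
Variable b0 : R.
Hypothesis Lady : ladyzhenskaya_constant Omega b0.
Variables (nu alpha : R).
Hypotheses (nu0 : 0 < nu) (alpha0 : 0 < alpha).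
Implicit Types (f : @vector_field R).
Local Notation state := (@vector_field R * @tensor_field R)%type.
Implicit Types (p q x : state).

Let Pv := L2v_psd mO.
Let Pt := L2t_psd mO.
Let Pa := H1_psd mO (sqr_ge0 alpha).

(** A state is a field together with a representative of its weak gradient, because the gradient is
    not a function of the field here. *)
Definition voigt p q : R := ipv Omega p.1 q.1 + alpha ^+ 2 * ipt Omega p.2 q.2.

Definition nsv_rhs f p x : R :=
  ipv Omega f x.1 - nu * ipt Omega p.2 x.2 - ipv Omega (advection p.1 p.2) x.1.

Definition in_V p := Vspace Omega p.1 p.2.

Lemma in_V_L2 p : in_V p -> L2v Omega p.1 /\ L2t Omega p.2.
Proof. by move=> Vp; split; [exact: Vspace_L2v Vp|exact: Vspace_L2t Vp]. Qed.

Lemma in_V_B p q : in_V p -> in_V q -> in_V (p - q).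
Proof. by move=> Vp Vq; exact: (Vspace_B mO fO Vp Vq). Qed.

(** This uses [alpha > 0]: the Voigt energy controls the gradient as well. *)
Lemma normH1_voigt x : in_V x ->
  normH1 Omega x.1 x.2 <= Num.sqrt (1 + alpha ^- 2) * Num.sqrt (voigt x x).
Proof.
move=> Vx; have [Lx Ltx] := in_V_L2 Vx.
have a0 : 0 < alpha ^+ 2 by rewrite exprn_gt0.
have i0 : 0 < alpha ^- 2 by rewrite invr_gt0.
rewrite -sqrtrM ?addr_ge0 ?(ltW i0)// ler_wsqrtr// /voigt.
have := psd_ge0 Pv Lx; have := psd_ge0 Pt Ltx.
move: (ipv _ _ _) (ipt _ _ _) => n g g0 n0.
have -> : (1 + alpha ^- 2) * (n + alpha ^+ 2 * g) = n + g + (alpha ^- 2 * n + alpha ^+ 2 * g).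
  by field; rewrite lt0r_neq0.
by rewrite lerDl addr_ge0// mulr_ge0// ltW.
Qed.

(** The bound, linear in the Voigt norm of the test state, that [energy_derive] asks for. *)
Lemma nsv_rhs_bound f p x (K H : R) : L2v Omega f -> in_V p -> in_V x ->
  normv Omega f <= K -> normH1 Omega p.1 p.2 <= H ->
  `|nsv_rhs f p x| <=
    (K + nu * H + b0 * H ^+ 2) * Num.sqrt (1 + alpha ^- 2) * Num.sqrt (voigt x x).
Proof.
move=> Lf Vp Vx fK pH; have [Lp Ltp] := in_V_L2 Vp; have [Lx Ltx] := in_V_L2 Vx.
have b00 : 0 <= b0 by case: Lady => /ltW.
have Hx := normH1_voigt Vx.
have [nx gx] := normH1_ge mO Vx; have [np gp] := normH1_ge mO Vp.
have f0 : 0 <= normv Omega f := sqrtr_ge0 _.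
have H0 : 0 <= H by apply: le_trans pH; exact: sqrtr_ge0.
have K0 : 0 <= K by exact: le_trans fK.
have C0 : 0 <= K + nu * H + b0 * H ^+ 2.
  by rewrite !addr_ge0// mulr_ge0// ?exprn_ge0// ltW.
rewrite -mulrA; apply: le_trans (ler_wpM2l C0 Hx).
have x0 : 0 <= normH1 Omega x.1 x.2 := sqrtr_ge0 _.
have B1 := psd_cauchy_schwarz_sqrt Pv Lf Lx.
have B2 := psd_cauchy_schwarz_sqrt Pt Ltp Ltx.
have B3 := trilinear_bound mO Lady Vx Vp Ltp.
rewrite /nsv_rhs advectionE//; [|exact: (Vspace_L4v Lady Vp)|exact: (Vspace_L4v Lady Vx)].
have g0 : 0 <= normt Omega x.2 := sqrtr_ge0 _.
have n0 : 0 <= normv Omega x.1 := sqrtr_ge0 _.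
have gp0 : 0 <= normt Omega p.2 := sqrtr_ge0 _.
have hp0 : 0 <= normH1 Omega p.1 p.2 := sqrtr_ge0 _.
have C1 : `|ipv Omega f x.1| <= K * normH1 Omega x.1 x.2.
  exact: (le_trans B1 (ler_pM f0 n0 fK nx)).
have C2 : `|ipt Omega p.2 x.2| <= H * normH1 Omega x.1 x.2.
  exact: (le_trans B2 (ler_pM gp0 g0 (le_trans gp pH) gx)).
have C3 : `|ipt Omega (outer x.1 p.1) p.2| <= b0 * H ^+ 2 * normH1 Omega x.1 x.2.
  apply: (le_trans B3).
  rewrite [leRHS]mulrAC expr2 -[leLHS]mulrA.
  exact: (ler_wpM2l (mulr_ge0 b00 x0) (ler_pM hp0 gp0 pH (le_trans gp pH))).
move: C1 C2 C3; move: (ipv Omega f x.1) (ipt Omega p.2 x.2) (ipt Omega (outer x.1 p.1) p.2)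
  (normH1 Omega x.1 x.2) => A B C D C1 C2 C3.
apply: (le_trans (ler_normB _ _)); rewrite 2!mulrDl; apply: lerD => //.
apply: (le_trans (ler_normB _ _)); apply: lerD => //.
by rewrite normrM gtr0_norm// -mulrA ler_wpM2l// ltW.
Qed.

Section OneSolution.
Variables (F : R -> @vector_field R) (v0 : @vector_field R)
  (v : R -> @vector_field R) (Dv : R -> @tensor_field R).
Hypothesis Sv : nsv_weak_solution Omega nu alpha F v0 v Dv.

Lemma solution_locally_bounded (t : R) : 0 < t -> exists e H : R,
  0 < e /\ forall r, `|r - t| < e -> 0 < r -> normH1 Omega (v r) (Dv r) <= H.
Proof.
move=> t0; have Vt := nsv_in_V Sv (ltW t0).
have /cvgr0Pnorm_lt /(_ 1 ltr01) := nsv_continuous Sv (ltW t0).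
rewrite /prop_near1 /nbhs /= => -[e /= e0 he].
exists e, (normH1 Omega (v t) (Dv t) + 1); split => // r hr r0.
have Vr := nsv_in_V Sv (ltW r0).
have [Lr Ltr] := in_V_L2 (p := (v r, Dv r)) Vr; have [Lt Ltt] := in_V_L2 (p := (v t, Dv t)) Vt.
have := he r; rewrite /ball_ /= distrC => /(_ hr (ltW r0)).
rewrite ger0_norm ?sqrtr_ge0// => h1.
have P1 := H1_psd mO (ler01 : (0 : R) <= 1).
have := psd_triangle P1 (x := (v t, Dv t)) (y := (v r - v t, Dv r - Dv t)).
rewrite /= -!normH1E => T.
have := T (conj Lt Ltt) (conj (psd_SB Pv Lr Lt) (psd_SB Pt Ltr Ltt)).
rewrite [X in normH1 _ X _](_ : _ = v r); last by rewrite addrC subrK.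
rewrite [X in normH1 _ _ X](_ : _ = Dv r); last by rewrite addrC subrK.
by move=> h2; apply: (le_trans h2); rewrite lerD2l ltW.
Qed.

Lemma solution_rhs_locally_bounded (t K : R) : 0 < t ->
  (forall r, 0 < r -> L2v Omega (F r)) ->
  (exists2 e : R, 0 < e & forall r, `|r - t| < e -> 0 < r -> normv Omega (F r) <= K) ->
  exists e M : R, 0 < e /\ forall r x, `|r - t| < e -> 0 < r -> in_V x ->
    `|nsv_rhs (F r) (v r, Dv r) x| <= M * Num.sqrt (voigt x x).
Proof.
move=> t0 LF [e1 e10 h1]; have [e2 [H [e20 h2]]] := solution_locally_bounded t0.
exists (Num.min e1 e2); eexists; split; first by rewrite lt_min e10.
move=> r x; rewrite lt_min => /andP[r1 r2] r0 Vx.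
apply: nsv_rhs_bound => //; [exact: LF|exact: (nsv_in_V Sv (ltW r0))| |].
- exact: h1.
- exact: h2.
Qed.

Lemma solution_derive (s : R) x : 0 < s -> in_V x ->
  is_derive s (1 : R) (fun r => voigt (v r, Dv r) x) (nsv_rhs (F s) (v s, Dv s) x).
Proof. by move=> s0 Vx; exact: (nsv_equation Sv Vx s0). Qed.

End OneSolution.

End Solutions.

(** * Decay of the difference *)

Section Scalars.
Context {R : realType}.

(* The minimum of (P^2/4 + 3Q^2)^2 - 2/3 Q P^3 is attained at P = 6Q, where it
   vanishes; this fixes the constants. *)
Lemma young_sharp (nu b0 rho n g B : R) : 0 < nu -> 0 <= n -> 0 <= g ->
  B ^+ 2 <= 2 / 3 * (b0 ^+ 2 * n * g ^+ 3) * rho ->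
  `|B| <= nu / 4 * g ^+ 2 + 3 * b0 ^+ 4 * rho ^+ 2 / nu ^+ 3 * n ^+ 2.
Proof.
move=> nu0 n0 g0 HB.
pose Q := b0 ^+ 2 * rho * n / nu; pose P := nu * g.
have nuN : nu != 0 by exact: lt0r_neq0.
have -> : nu / 4 * g ^+ 2 + 3 * b0 ^+ 4 * rho ^+ 2 / nu ^+ 3 * n ^+ 2 =
    (P ^+ 2 / 4 + 3 * Q ^+ 2) / nu by rewrite /P /Q; field.
have S0 : 0 <= (P ^+ 2 / 4 + 3 * Q ^+ 2) / nu.
  by apply: divr_ge0 (ltW nu0); have := sqr_ge0 P; have := sqr_ge0 Q; lra.
rewrite -(ger0_norm S0) -ler_sqr ?nnegrE// !real_normK ?num_real//.
apply: (le_trans HB).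
have -> : 2 / 3 * (b0 ^+ 2 * n * g ^+ 3) * rho = 2 / 3 * Q * P ^+ 3 / nu ^+ 2.
  by rewrite /P /Q; field.
rewrite expr_div_n ler_wpM2r ?invr_ge0 ?sqr_ge0// -subr_ge0.
have -> : (P ^+ 2 / 4 + 3 * Q ^+ 2) ^+ 2 - 2 / 3 * Q * P ^+ 3 =
  (P - 6 * Q) ^+ 2 * ((P / 4 + Q / 6) ^+ 2 + 2 / 9 * Q ^+ 2) by field.
rewrite mulr_ge0 ?sqr_ge0//.
by have := sqr_ge0 (P / 4 + Q / 6); have := sqr_ge0 Q; lra.
Qed.

(** At e = 0 the left sides are 8/9 of K = C1 rad^2 b0^4, which the hypotheses put below both
    targets. The margin for e is a fraction of the smaller target [m] and not of K, since [rad] may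
    be 0. *)
Lemma slack_exists (nu b0 mu l rad : R) : 0 < nu -> 0 < b0 -> 0 < mu -> 0 < l ->
  C1 nu * rad ^+ 2 * b0 ^+ 4 <= mu ->
  0 < nu - 4 * l^-1 * C1 nu * rad ^+ 2 * b0 ^+ 4 ->
  exists2 e : R, 0 < e &
    3 * b0 ^+ 4 * (rad / 2 + e) ^+ 2 / nu ^+ 3 <= mu /\
    3 * b0 ^+ 4 * (rad / 2 + e) ^+ 2 / nu ^+ 3 <= nu * l / 4.
Proof.
move=> nu0 b00 mu0 l0 H1 H2.
pose K := C1 nu * rad ^+ 2 * b0 ^+ 4.
have nuN : nu != 0 by exact: lt0r_neq0.
have H3 : K <= nu * l / 4.
  have : 0 < l / 4 * (nu - 4 * l^-1 * C1 nu * rad ^+ 2 * b0 ^+ 4).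
    by rewrite mulr_gt0// divr_gt0.
  have -> : l / 4 * (nu - 4 * l^-1 * C1 nu * rad ^+ 2 * b0 ^+ 4) = nu * l / 4 - K.
    by rewrite /K; field; exact: lt0r_neq0.
  by rewrite subr_gt0 => /ltW.
pose m := Num.min mu (nu * l / 4).
have m0 : 0 < m by rewrite lt_min mu0 divr_gt0// mulr_gt0.
have Km : K <= m by rewrite le_min H3 H1.
(* Completing the square in the cross term rad e raises 16/18 of K to 17/18 and the coefficient 3 of
   e^2 to 51; the last 1/18 of m is left for D e^2. *)
pose D := 51 * b0 ^+ 4 / nu ^+ 3.
have D0 : 0 < D by rewrite divr_gt0 ?mulr_gt0 ?exprn_gt0.
pose e := Num.min 1 (m / 18 / D).
have e0 : 0 < e by rewrite lt_min ltr01 divr_gt0// divr_gt0.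
suff H : 3 * b0 ^+ 4 * (rad / 2 + e) ^+ 2 / nu ^+ 3 <= m.
  by exists e => //; split; apply: (le_trans H); rewrite /m ge_min lexx ?orbT.
have e1 : D * e ^+ 2 <= m / 18.
  have e2 : e ^+ 2 <= e.
    by rewrite expr2 ler_piMr ?(ltW e0)// ge_min lexx.
  have e3 : e <= m / 18 / D by rewrite /e ge_min lexx orbT.
  by rewrite mulrC -ler_pdivlMr//; exact: le_trans e2 e3.
have E : 3 * b0 ^+ 4 * (rad / 2 + e) ^+ 2 / nu ^+ 3 =
    17 / 18 * K + D * e ^+ 2 - 3 * b0 ^+ 4 / nu ^+ 3 * (rad / 8 - 4 * e) ^+ 2.
  by rewrite /K /D /C1; field.
have h : 0 <= 3 * b0 ^+ 4 / nu ^+ 3 * (rad / 8 - 4 * e) ^+ 2.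
  by rewrite mulr_ge0 ?sqr_ge0// divr_ge0 ?mulr_ge0 ?exprn_ge0 ?ltW.
by rewrite E; lra.
Qed.

(* exp(-x) <= 1/(1+x) gives an explicit time after which the transient is small. *)
Lemma expR_decay_small (k E0 e t : R) : 0 < k -> 0 <= E0 -> 0 < e ->
  E0 / (k * e) <= t -> expR (- k * t) * E0 <= e.
Proof.
move=> k0 E00 e0 ht; have ke : 0 < k * e by rewrite mulr_gt0.
rewrite mulNr expRN mulrC ler_pdivrMr ?expR_gt0//.
have h := expR_ge1Dx (k * t).
apply: le_trans (ler_wpM2l (ltW e0) h).
move: ht; rewrite ler_pdivrMr// mulrDr mulr1 => ht.
have -> : e * (k * t) = t * (k * e) by ring.
by lra.
Qed.

End Scalars.

Section Decay.
Context {R : realType} (Omega : set (R * R * R)).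
Hypothesis mO : measurable (Omega : set (@R3 R)).
Hypothesis fO : (leb3 (Omega : set (@R3 R)) < +oo)%E.
Variable b0 : R.
Hypothesis Lady : ladyzhenskaya_constant Omega b0.
Variables (nu alpha mu : R).
Hypotheses (nu0 : 0 < nu) (alpha0 : 0 < alpha) (mu0 : 0 < mu).
Variables (lam : nat -> R) (w : nat -> @vector_field R) (Dw : nat -> @tensor_field R).
Hypothesis HE : stokes_eigenbasis Omega lam w Dw.
Variable h : @vector_field R.
Hypothesis Lh : L2v Omega h.
Variables (v0 : @vector_field R) (v : R -> @vector_field R) (Dv : R -> @tensor_field R).
Hypothesis Sv : nsv_weak_solution Omega nu alpha (fun=> h) v0 v Dv.

Let Pv := L2v_psd mO.
Let Pt := L2t_psd mO.
Let Pa := H1_psd mO (sqr_ge0 alpha).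
Local Notation E p := (voigt Omega alpha p p).
Local Notation m := (Num.min (lam 0%N) (alpha ^- 2)).

Lemma E_norms p : in_V Omega p ->
  E p = normv Omega p.1 ^+ 2 + alpha ^+ 2 * normt Omega p.2 ^+ 2.
Proof.
move=> Vp; have [Lp Ltp] := in_V_L2 Vp.
by rewrite /normv /normt !sqr_sqrtr// ?(psd_ge0 Pv)// (psd_ge0 Pt).
Qed.

(** Half of |grad|^2 pays for each part of the energy: the first through Poincare and m <= lambda_1,
    the second through m <= alpha^-2. Multiplied by nu, this is the origin of [d0]. *)
Lemma E_le_dissipation p : in_V Omega p -> m / 2 * E p <= normt Omega p.2 ^+ 2.
Proof.
move=> Vp; rewrite E_norms//.
have := poincare mO fO HE Vp.
move: (normv Omega p.1) (normt Omega p.2) => n g ng.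
have a2 : 0 < alpha ^+ 2 by rewrite exprn_gt0.
have m1 : m * n ^+ 2 <= g ^+ 2.
  by apply: le_trans ng; rewrite ler_wpM2r ?sqr_ge0// ge_min lexx.
have m2 : m * (alpha ^+ 2 * g ^+ 2) <= g ^+ 2.
  rewrite mulrA ler_piMl ?sqr_ge0// -ler_pdivlMr// mul1r.
  by rewrite ge_min lexx orbT.
have -> : m / 2 * (n ^+ 2 + alpha ^+ 2 * g ^+ 2) =
  (m * n ^+ 2 + m * (alpha ^+ 2 * g ^+ 2)) / 2 by field.
by lra.
Qed.

Lemma free_energy_derive (t : R) : 0 < t ->
  is_derive t (1 : R) (fun s => E (v s, Dv s))
    (2 * nsv_rhs Omega nu h (v t, Dv t) (v t, Dv t)).
Proof.
move=> t0.
have [e [M [e0 bd]]] := solution_rhs_locally_bounded mO Lady nu0 alpha0 Sv t0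
  (fun _ _ => Lh) (ex_intro2 _ _ 1 ltr01 (fun _ _ _ => lexx (normv Omega h))).
apply: (energy_derive Pa (T := in_V Omega) (z := fun s => (v s, Dv s))
  (F := fun s x => nsv_rhs Omega nu h (v s, Dv s) x) _ _ _ _ t0 e0 bd).
- by move=> x; exact: in_V_L2.
- by move=> x y; exact: in_V_B.
- by move=> s s0; exact: (nsv_in_V Sv (ltW s0)).
- by move=> s x s0 Vx; exact: (solution_derive Sv s0 Vx).
Qed.

(** The energy satisfies E' <= c - d0 E, so its limsup is at most c / d0; since alpha^2 |grad v|^2
    <= E, the gradient gets c / (d0 alpha^2) = r0 / 2. *)
Lemma absorbing (e : R) : 0 < e -> exists2 t0 : R, 0 < t0 & forall t, t0 <= t ->
  normt Omega (Dv t) ^+ 2 <=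
    r0 nu alpha (lam 0%N) (normv Omega h) / 2 + e.
Proof.
move=> e0.
have l0 : 0 < lam 0%N := eigen_gt0 HE 0.
have a2 : 0 < alpha ^+ 2 by rewrite exprn_gt0.
have m0 : 0 < m by rewrite lt_min l0 invr_gt0.
have d00 : 0 < d0 nu alpha (lam 0%N) by rewrite /d0 mulr_gt0// divr_gt0.
pose c := normv Omega h ^+ 2 / (nu * lam 0%N).
have c0 : 0 <= c by rewrite divr_ge0 ?sqr_ge0// mulr_ge0// ltW.
(* Time 1 serves as the origin because the equation is available at positive times only. *)
have VV s : 1 <= s -> in_V Omega (v s, Dv s).
  by move=> s1; exact: (nsv_in_V Sv (le_trans ler01 s1)).
have dE s : 1 <= s -> 2 * nsv_rhs Omega nu h (v s, Dv s) (v s, Dv s) <=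
    c - d0 nu alpha (lam 0%N) * E (v s, Dv s).
  move=> s1; have Vs := VV s s1; have [Ls Lts] := in_V_L2 Vs.
  have L4 := Vspace_L4v Lady Vs.
  rewrite /nsv_rhs advectionE// (trilinear0 mO fO Lady Vs Vs) subr0.
  have H1 := psd_cauchy_schwarz_sqrt Pv Lh Ls.
  have H2 := poincare mO fO HE Vs.
  have H3 := E_le_dissipation Vs.
  have gE : ipt Omega (Dv s) (Dv s) = normt Omega (Dv s) ^+ 2.
    by rewrite sqr_sqrtr// (psd_ge0 Pt).
  rewrite gE.
  have H4 : d0 nu alpha (lam 0%N) * E (v s, Dv s) <= nu * normt Omega (Dv s) ^+ 2.
    rewrite /d0 (_ : nu / 2 * m * E (v s, Dv s) = nu * (m / 2 * E (v s, Dv s))).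
      by rewrite ler_wpM2l// ltW.
    by field.
  (* Young with weight nu lambda_1 and then Poincare spend half of the dissipation 2 nu |grad v|^2;
     the other half bounds d0 E. *)
  have H5 : 2 * ipv Omega h (v s) <= c + nu * normt Omega (Dv s) ^+ 2.
    apply: (@le_trans _ _ (2 * (normv Omega h * normv Omega (v s)))).
      by rewrite ler_wpM2l//; exact: le_trans (ler_norm _) H1.
    apply: (@le_trans _ _ (c + nu * (lam 0%N * normv Omega (v s) ^+ 2))).
      have nl : 0 < nu * lam 0%N by rewrite mulr_gt0.
      rewrite -subr_ge0.
      have -> : c + nu * (lam 0%N * normv Omega (v s) ^+ 2) -
        2 * (normv Omega h * normv Omega (v s)) =
        (normv Omega h - nu * lam 0%N * normv Omega (v s)) ^+ 2 / (nu * lam 0%N).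
        by rewrite /c; field; rewrite !lt0r_neq0.
      by rewrite divr_ge0 ?sqr_ge0// ltW.
    by rewrite lerD2l ler_wpM2l// ltW.
  move: H4 H5; move: (ipv _ _ _) (voigt _ _ _ _) (normt _ _ ^+ 2) => A B G H4 H5.
  by lra.
have E1 : 0 <= E (v 1, Dv 1) by apply: (psd_ge0 Pa); exact: (in_V_L2 (VV _ (lexx _))).
have ea : 0 < e * alpha ^+ 2 by rewrite mulr_gt0.
pose T := E (v 1, Dv 1) / (d0 nu alpha (lam 0%N) * (e * alpha ^+ 2)).
have T0 : 0 <= T by rewrite divr_ge0// ltW// mulr_gt0.
exists (1 + T); first by rewrite ltr_pwDl.
move=> t ht.
have t1 : 1 <= t by apply: le_trans ht; rewrite lerDl.
have G := gronwall d00 c0 (fun s hs => free_energy_derive (lt_le_trans ltr01 hs)) dE t1.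
have small := @expR_decay_small _ _ _ _ (t - 1) d00 E1 ea.
have {}small : expR (- d0 nu alpha (lam 0%N) * (t - 1)) * E (v 1, Dv 1) <= e * alpha ^+ 2.
  by apply: small; rewrite -/T lerBrDl.
have rE : r0 nu alpha (lam 0%N) (normv Omega h) / 2 = c / d0 nu alpha (lam 0%N) / alpha ^+ 2.
  by rewrite /r0 /c; field; rewrite !lt0r_neq0.
rewrite rE -(ler_pM2l a2) mulrDr (mulrC _ e).
have -> : alpha ^+ 2 * (c / d0 nu alpha (lam 0%N) / alpha ^+ 2) = c / d0 nu alpha (lam 0%N).
  by field; rewrite !lt0r_neq0.
apply: (@le_trans _ _ (E (v t, Dv t))).
  by rewrite (E_norms (VV t t1)) /= lerDr sqr_ge0.
apply: (le_trans G); rewrite addrC lerD2l.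
exact: small.
Qed.

Section Feedback.
Variables (N : nat) (u0 : @vector_field R)
  (u : R -> @vector_field R) (Du : R -> @tensor_field R).
Hypothesis Su : nsv_weak_solution Omega nu alpha
  (fun t => feedback_force Omega mu N w h (u t - v t)) u0 u Du.
Local Notation f t := (feedback_force Omega mu N w h (u t - v t)).
Local Notation z t := ((u t, Du t) - (v t, Dv t)).

Lemma feedback_forceE d : feedback_force Omega mu N w h d =
  (- mu) *: modes Omega w N d + h.
Proof. by []. Qed.

Lemma diff_in_V (t : R) : 0 < t -> in_V Omega (z t).
Proof.
move=> t0; apply: (in_V_B mO fO).
  exact: (nsv_in_V Su (ltW t0)).
exact: (nsv_in_V Sv (ltW t0)).
Qed.

Lemma feedback_L2v (t : R) : 0 < t -> L2v Omega (f t).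
Proof.
move=> t0; rewrite feedback_forceE; apply: (psd_SD Pv) => //; apply: (psd_SZ Pv).
exact: (modes_L2v mO HE).
Qed.

Lemma feedback_locally_bounded (t : R) : 0 < t -> exists K : R,
  exists2 e : R, 0 < e & forall r, `|r - t| < e -> 0 < r -> normv Omega (f r) <= K.
Proof.
move=> t0.
have [e1 [H1 [e10 h1]]] := solution_locally_bounded mO Su t0.
have [e2 [H2 [e20 h2]]] := solution_locally_bounded mO Sv t0.
exists (mu * (H1 + H2) + normv Omega h), (Num.min e1 e2); first by rewrite lt_min e10.
move=> r; rewrite lt_min => /andP[r1 r2] r0.
have Vu := nsv_in_V Su (ltW r0); have Vv := nsv_in_V Sv (ltW r0).
have Lu := Vspace_L2v Vu; have Lv := Vspace_L2v Vv; have Lz := psd_SB Pv Lu Lv.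
have Lm := modes_L2v mO HE N (u r - v r).
rewrite feedback_forceE.
apply: (le_trans (psd_triangle Pv (psd_SZ Pv (- mu) Lm) Lh)); rewrite lerD2r.
rewrite (psd_Zl Pv)//; last exact: (psd_SZ Pv).
rewrite (psd_Zr Pv)// mulrA mulrNN sqrtrM ?mulr_ge0 ?(ltW mu0)// -expr2 sqrtr_sqr gtr0_norm//.
rewrite ler_wpM2l ?(ltW mu0)//; apply: (le_trans (normv_modes_le mO HE N Lz)).
have := psd_triangle Pv Lu (psd_SN Pv Lv).
rewrite (psd_Nl Pv)//; last exact: (psd_SN Pv).
rewrite (psd_Nr Pv)// opprK => T; apply: (le_trans T); apply: lerD.
  by apply: le_trans (h1 r r1 r0); case: (normH1_ge mO Vu).
by apply: le_trans (h2 r r2 r0); case: (normH1_ge mO Vv).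
Qed.

Lemma diff_energy_derive (t : R) : 0 < t ->
  is_derive t (1 : R) (fun s => E (z s))
    (2 * (nsv_rhs Omega nu (f t) (u t, Du t) (z t) - nsv_rhs Omega nu h (v t, Dv t) (z t))).
Proof.
move=> t0.
have [e1 [M1 [e10 b1]]] := solution_rhs_locally_bounded mO Lady nu0 alpha0 Sv t0
  (fun _ _ => Lh) (ex_intro2 _ _ 1 ltr01 (fun _ _ _ => lexx (normv Omega h))).
have [K HK] := feedback_locally_bounded t0.
have [e2 [M2 [e20 b2]]] := solution_rhs_locally_bounded mO Lady nu0 alpha0 Su t0 feedback_L2v HK.
have e0 : 0 < Num.min e1 e2 by rewrite lt_min e10.
apply: (energy_derive (a := voigt Omega alpha) Pa (T := in_V Omega) (z := fun s => z s)
  (F := fun s x => nsv_rhs Omega nu (f s) (u s, Du s) x - nsv_rhs Omega nu h (v s, Dv s) x)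
  (M := M2 + M1) _ _ _ _ t0 e0).
- by move=> x; exact: in_V_L2.
- by move=> x y; exact: in_V_B.
- by move=> s s0; exact: diff_in_V.
- move=> s x s0 Vx.
  have D := is_deriveB (solution_derive Su s0 Vx) (solution_derive Sv s0 Vx).
  (* Linearity in the first argument requires both fields in L^2, which is known near t because t >
     0. *)
  apply: near_eq_is_derive D; near=> r.
  have r0 : 0 < r by near: r; exact: lt_nbhsr.
  apply/esym; apply: (psd_Bl Pa).
  + exact: (in_V_L2 (p := (u r, Du r)) (nsv_in_V Su (ltW r0))).
  + exact: (in_V_L2 (p := (v r, Dv r)) (nsv_in_V Sv (ltW r0))).
  + exact: in_V_L2.
- move=> r x; rewrite lt_min => /andP[r1 r2] r0 Vx.
  apply: (le_trans (ler_normB _ _)); rewrite mulrDl; apply: lerD.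
    exact: b2.
  exact: b1.
Unshelve. all: end_near. Qed.

(** With u = v + z, the difference of the advection terms tested with z is (z (x) u, Dz) + (z (x) z,
    Dv), and the first product vanishes by [trilinear0]. *)
Lemma diff_rhs (t : R) : 0 < t ->
  nsv_rhs Omega nu (f t) (u t, Du t) (z t) - nsv_rhs Omega nu h (v t, Dv t) (z t) =
  - mu * \sum_(k < N) ipv Omega (z t).1 (w k) ^+ 2 - nu * normt Omega (z t).2 ^+ 2
  - ipt Omega (outer (z t).1 (z t).1) (Dv t).
Proof.
move=> t0; have Vz := diff_in_V t0.
have Vu : in_V Omega (u t, Du t) := nsv_in_V Su (ltW t0).
have Vv : in_V Omega (v t, Dv t) := nsv_in_V Sv (ltW t0).
have [Lz Ltz] := in_V_L2 Vz; have [Lu Ltu] := in_V_L2 Vu; have [Lv Ltv] := in_V_L2 Vv.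
have L4z := Vspace_L4v Lady Vz; have L4u := Vspace_L4v Lady Vu; have L4v' := Vspace_L4v Lady Vv.
rewrite /nsv_rhs !advectionE// feedback_forceE.
have Lm := modes_L2v mO HE N (u t - v t).
rewrite (psd_Dl Pv)//; last exact: (psd_SZ Pv).
rewrite (psd_Zl Pv)// (ipv_modes mO HE)//.
have -> : \sum_(k < N) ipv Omega (u t - v t) (w k) * ipv Omega (w k) (z t).1 =
    \sum_(k < N) ipv Omega (z t).1 (w k) ^+ 2.
  by apply: eq_bigr => k _; rewrite expr2 [in RHS](psd_sym Pv _ (w k)) (psd_sym Pv _ (w k)).
have gE : normt Omega (z t).2 ^+ 2 = ipt Omega (Du t) (z t).2 - ipt Omega (Dv t) (z t).2.
  by rewrite sqr_sqrtr ?(psd_ge0 Pt)// [X in ipt _ X _](_ : _ = Du t - Dv t)// (psd_Bl Pt).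
have uE : u t = v t + (z t).1 by rewrite /= addrC subrK.
have Ozu := outer_L2t mO L4z L4u; have Ozv := outer_L2t mO L4z L4v'.
have Ozz := outer_L2t mO L4z L4z.
have B0 : ipt Omega (outer (z t).1 (u t)) (z t).2 = 0 := trilinear0 mO fO Lady Vu Vz.
have B1 : ipt Omega (outer (z t).1 (u t)) (Du t) = ipt Omega (outer (z t).1 (u t)) (Dv t).
  move: B0; rewrite [X in ipt _ _ X](_ : _ = Du t - Dv t)// (psd_Br Pt)// => /eqP.
  by rewrite subr_eq0 => /eqP.
have B2 : ipt Omega (outer (z t).1 (u t)) (Dv t) =
    ipt Omega (outer (z t).1 (v t)) (Dv t) + ipt Omega (outer (z t).1 (z t).1) (Dv t).
  by rewrite -(psd_Dl Pt)// -outerDr -uE.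
rewrite gE B1 B2.
move: (\sum_(k < N) _) => S.
move: (ipt Omega (Du t) _) (ipt Omega (Dv t) _) (ipv Omega h _) => A B C.
rewrite /=.
by ring.
Qed.

(** E' / 2 is at most (- nu + nu / 4 + nu / 4) |grad z|^2: one quarter comes from Young, the other
    from the high modes, while mu pays for the low ones. Hence E' <= - nu |grad z|^2 <= - d0 E. *)
Lemma feedback_decay (t0 rho : R) : 0 < t0 -> 0 <= rho ->
  (forall t, t0 <= t -> normt Omega (Dv t) ^+ 2 <= rho) ->
  3 * b0 ^+ 4 * rho ^+ 2 / nu ^+ 3 <= mu ->
  3 * b0 ^+ 4 * rho ^+ 2 / nu ^+ 3 <= nu * lam N / 4 ->
  forall t, t0 <= t ->
    E (z t) <= expR (- d0 nu alpha (lam 0%N) * (t - t0)) * E (z t0).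
Proof.
move=> t00 rho0 Hv A1 A2 t tt.
have l0 : 0 < lam 0%N := eigen_gt0 HE 0.
have lN : 0 < lam N := eigen_gt0 HE N.
have m0 : 0 < m by rewrite lt_min l0 invr_gt0 exprn_gt0.
have d00 : 0 < d0 nu alpha (lam 0%N) by rewrite /d0 mulr_gt0// divr_gt0.
pose dE s := 2 * (nsv_rhs Omega nu (f s) (u s, Du s) (z s) - nsv_rhs Omega nu h (v s, Dv s) (z s)).
have bE s : t0 <= s -> dE s <= 0 - d0 nu alpha (lam 0%N) * E (z s).
  move=> hs; have s0 := lt_le_trans t00 hs; have Vz := diff_in_V s0.
  have Vv : in_V Omega (v s, Dv s) := nsv_in_V Sv (ltW s0).
  have H3 := E_le_dissipation Vz.
  have H4 : d0 nu alpha (lam 0%N) * E (z s) <= nu * normt Omega (z s).2 ^+ 2.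
    rewrite /d0 (_ : nu / 2 * m * E (z s) = nu * (m / 2 * E (z s))).
      by rewrite ler_wpM2l// ltW.
    by field.
  have H5 := poincare_modes mO fO HE N Vz.
  have [Lz Ltz] := in_V_L2 Vz.
  have nn : ipv Omega (z s).1 (z s).1 = normv Omega (z s).1 ^+ 2.
    by rewrite sqr_sqrtr// (psd_ge0 Pv).
  have gg : ipt Omega (z s).2 (z s).2 = normt Omega (z s).2 ^+ 2.
    by rewrite sqr_sqrtr// (psd_ge0 Pt).
  rewrite nn gg in H5.
  have n0 : 0 <= normv Omega (z s).1 := sqrtr_ge0 _.
  have g0 : 0 <= normt Omega (z s).2 := sqrtr_ge0 _.
  have H6 : ipt Omega (outer (z s).1 (z s).1) (Dv s) ^+ 2 <=
      2 / 3 * (b0 ^+ 2 * normv Omega (z s).1 * normt Omega (z s).2 ^+ 3) * rho.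
    apply: (le_trans (trilinear_sharp mO fO Lady Vz Vv)); apply: ler_wpM2l.
      by rewrite mulr_ge0 ?divr_ge0// mulr_ge0 ?exprn_ge0// mulr_ge0 ?sqr_ge0.
    exact: Hv.
  have {}H6 := young_sharp nu0 n0 g0 H6.
  rewrite /dE diff_rhs//.
  set A := 3 * b0 ^+ 4 * rho ^+ 2 / nu ^+ 3 in A1 A2 H6.
  have A0 : 0 <= A.
    apply: divr_ge0; last by rewrite exprn_ge0// ltW.
    by rewrite mulr_ge0 ?sqr_ge0// mulr_ge0// (exprM _ 2 2) sqr_ge0.
  set S := \sum_(k < N) _ in H5 *.
  have S0 : 0 <= S by apply: sumr_ge0 => k _; exact: sqr_ge0.
  have := sqr_ge0 (normt Omega (z s).2).
  move: H4 H5 H6; move: (ipt _ _ _) (voigt _ _ _ _) => B EE.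
  move: (normv _ _ ^+ 2) (normt _ _ ^+ 2) => n2 g2 H4 H5 H6 g20.
  have B1 : - B <= nu / 4 * g2 + A * n2 by apply: le_trans H6; rewrite -normrN ler_norm.
  have B2 : A * n2 <= mu * S + nu / 4 * g2.
    (* [S] is the part of |z|^2 in the first N modes, where A <= mu applies; on the rest, the
       spectral gap is combined with A / lam N <= nu / 4. *)
    have -> : A * n2 = A * S + A / lam N * (lam N * (n2 - S)) by field; exact: lt0r_neq0.
    apply: lerD; first exact: ler_wpM2r.
    apply: (@le_trans _ _ (A / lam N * g2)).
      by rewrite ler_wpM2l// divr_ge0// ltW.
    by rewrite ler_wpM2r// ler_pdivrMr// mulrAC.
  by lra.
have := gronwall d00 (lexx 0) (fun s hs => diff_energy_derive (lt_le_trans t00 hs)) bE tt.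
by rewrite mul0r addr0.
Qed.

End Feedback.
End Decay.

(** * From the decay of the energy to that of the gradient *)

Unset Implicit Arguments.

Theorem theorem2p1 (R : realType) (Omega : set (R * R * R))
  (nu alpha mu b0 : R) (N : nat)
  (lam : nat -> R) (w : nat -> @vector_field R) (Dw : nat -> @tensor_field R)
  (h u0 v0 : @vector_field R) (Du0 Dv0 : @tensor_field R)
  (u v : R -> @vector_field R) (Du Dv : R -> @tensor_field R) :
  smooth_bounded_domain Omega ->
  0 < nu -> 0 < alpha -> 0 < mu -> (1 <= N)%N ->
  stokes_eigenbasis Omega lam w Dw ->
  ladyzhenskaya_constant Omega b0 ->
  L2v Omega h -> Vspace Omega u0 Du0 -> Vspace Omega v0 Dv0 ->
  nsv_weak_solution Omega nu alpha (fun=> h) v0 v Dv ->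
  nsv_weak_solution Omega nu alpha
    (fun t => feedback_force Omega mu N w h (u t - v t)) u0 u Du ->
  let lam1 := lam 0%N in
  let rad := r0 nu alpha lam1 (normv Omega h) in
  C1 nu * rad ^+ 2 * b0 ^+ 4 <= mu ->
  0 < nu - 4 * (lam N)^-1 * C1 nu * rad ^+ 2 * b0 ^+ 4 ->
  exists t0 : R, 0 < t0 /\
    forall t, t0 <= t ->
      normt Omega (Du t - Dv t) <=
      k0 alpha lam1 * expR (- kappa nu alpha lam1 * (t - t0)) *
      normt Omega (Du t0 - Dv t0).
Proof.
move=> dO nu0 alpha0 mu0 _ HE Lady Lh _ _ Sv Su lam1 rad Hmu Hnu.
have mO := domain_measurable dO; have fO := domain_finite_measure dO.
have l0 : 0 < lam1 := eigen_gt0 HE 0.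
have [e e0 [A1 A2]] := slack_exists nu0 (proj1 Lady) mu0 (eigen_gt0 HE N) Hmu Hnu.
have a2 : 0 < alpha ^+ 2 by rewrite exprn_gt0.
have m0 : 0 < Num.min lam1 (alpha ^- 2) by rewrite lt_min l0 invr_gt0.
have rad0 : 0 <= rad.
  rewrite /rad /r0 mulr_ge0 ?sqr_ge0// divr_ge0// ltW//.
  by rewrite !mulr_gt0// /d0 mulr_gt0// divr_gt0.
have rho0 : 0 <= rad / 2 + e by rewrite addr_ge0 ?divr_ge0// ltW.
have [t0 t00 Hv] := absorbing mO fO Lady nu0 alpha0 HE Lh Sv e0.
exists t0; split=> // t tt.
have := feedback_decay mO fO Lady nu0 alpha0 mu0 HE Lh Sv Su t00 rho0 Hv A1 A2 tt.
have Vt : in_V Omega ((u t, Du t) - (v t, Dv t)).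
  exact: (diff_in_V mO fO Sv Su (lt_le_trans t00 tt)).
have Vt0 : in_V Omega ((u t0, Du t0) - (v t0, Dv t0)) by exact: (diff_in_V mO fO Sv Su t00).
rewrite !(E_norms mO)//=.
have := poincare mO fO HE Vt0; rewrite /= -/lam1.
(* The energy thus decays like the square of the claimed exponential. *)
have -> : d0 nu alpha lam1 = 2 * kappa nu alpha lam1 by rewrite /d0 /kappa; field.
have kap0 : 0 <= kappa nu alpha lam1 by rewrite /kappa ltW// mulr_gt0// divr_gt0.
have g0 : 0 <= normt Omega (Du t - Dv t) := sqrtr_ge0 _.
have g00 : 0 <= normt Omega (Du t0 - Dv t0) := sqrtr_ge0 _.
have -> : - (2 * kappa nu alpha lam1) * (t - t0) =
  - kappa nu alpha lam1 * (t - t0) + - kappa nu alpha lam1 * (t - t0).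
  by ring.
rewrite expRD -expr2.
have := expR_ge0 (- kappa nu alpha lam1 * (t - t0)).
move: (expR _) (normt _ (Du t - _)) (normt _ (Du t0 - _)) (normv _ (u t - _))
  (normv _ (u t0 - _)) g0 g00 => E g G n M g0 G0 E0 HM HE2.
have k1 : 1 <= k0 alpha lam1 by rewrite /k0 lerDl divr_ge0// mulr_ge0// ltW.
have kE : alpha ^+ 2 * k0 alpha lam1 = alpha ^+ 2 + lam1^-1.
  by rewrite /k0; field; rewrite !lt0r_neq0.
(* Poincare at t0 absorbs |z(t0)|^2, whence the term 1 / (alpha^2 lambda_1) of [k0]. *)
have H1 : M ^+ 2 + alpha ^+ 2 * G ^+ 2 <= alpha ^+ 2 * k0 alpha lam1 * G ^+ 2.
  rewrite kE mulrDl addrC lerD2l mulrC ler_pdivlMr// mulrC.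
  exact: HM.
have H2 : g ^+ 2 <= k0 alpha lam1 * (E * G) ^+ 2.
  rewrite -(ler_pM2l a2); apply: (@le_trans _ _ (n ^+ 2 + alpha ^+ 2 * g ^+ 2)).
    by rewrite lerDr sqr_ge0.
  apply: (le_trans HE2); apply: (le_trans (ler_wpM2l (sqr_ge0 E) H1)).
  by rewrite exprMn mulrCA -!mulrA mulrCA.
have k00 : 0 <= k0 alpha lam1 := le_trans ler01 k1.
have R0 : 0 <= k0 alpha lam1 * E * G by rewrite !mulr_ge0.
rewrite -ler_sqr ?nnegrE//; apply: (le_trans H2).
rewrite -mulrA [leRHS]exprMn ler_wpM2r ?sqr_ge0//.
(* The estimate holds with the square root of [k0], which is at most [k0] because k0 >= 1. *)
by rewrite expr2 ler_peMr.
Qed.
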